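(* There exist absolute constants $C,k>0$ such that the following holds for every prime power $q$. Let $A,X\subseteq\mathbb{F}_q^*$ be sets and $K$ be a positive real number. Suppose \[ C(\log q)^kK^{1504}\le |X|,\qquad C(\log q)^k q^{1/4}K^4\le |X|<q^{1/2},\qquad C(\log q)^k q^{1/2}K^{85}\le |A|\le q^{2/3}, \] and $E(A,\xi A)\ge |A|^3/K$ for all $\xi\in X$. Then there exist a subfield $F\subseteq\mathbb{F}_q$ of cardinality $q^{1/3}$, an element $\bar a\in A$, and a two-dimensional vector space $V\subseteq\mathbb{F}_q$ over $F$ such that \[ |(A-\bar a)\cap V|\ \ge\ C^{-1}(\log q)^{-k}K^{-85}|A|. \]
   Context: $\mathbb{F}_q$ is the finite field with $q$ elements, $\mathbb{F}_q^*=\mathbb{F}_q\setminus\{0\}$. For $A\subseteq\mathbb{F}_q$ and $\xi\in\mathbb{F}_q^*$, $E(A,\xi A)=|\{(a_1,a_2,a_3,a_4)\in A^4: a_1-a_2=\xi(a_3-a_4)\}|$. Also $A-\bar a=\{a-\bar a:a\in A\}$. *)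

(* Defs.v *)
From mathcomp Require Import all_boot all_order all_algebra all_field.

Set Implicit Arguments.
Unset Strict Implicit.
Unset Printing Implicit Defensive.

Import GRing.Theory.

Local Open Scope ring_scope.

(* E(A, xi A), as a number of quadruples (((a1, a2), a3), a4) in A ^ 4. *)
Definition energy_dilate (F : finFieldType) (A : {set F}) (xi : F) : nat :=
  #|[set t : F * F * F * F |
      let: (a1, a2, a3, a4) := t in
      [&& a1 \in A, a2 \in A, a3 \in A, a4 \in A
        & a1 - a2 == xi * (a3 - a4)]]|.

Definition translate (F : finFieldType) (A : {set F}) (b : F) : {set F} :=
  [set a - b | a in A].

(* A finite field F of characteristic p, regarded as an extension of 'F_p. The *)
(* carrier of fieldExt_of charFp is F itself, and {subfield fieldExt_of charFp} *)
(* ranges over all subfields of F, since each of them contains 'F_p.           *)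
Definition fieldExt_of (F : finFieldType) (p : nat) (charFp : p \in [pchar F])
    : fieldExtType 'F_p :=
  pPrimeCharType charFp.

(* The underlying subsets of F. The carrier of fieldOver S is again F, with    *)
(* scalars restricted to S, so \dim of V : {vspace fieldOver S} is dim_S V.    *)
Definition subfield_set (F : finFieldType) (p : nat)
    (charFp : p \in [pchar F]) (S : {subfield fieldExt_of charFp}) : {set F} :=
  [set x : F | (x : fieldExt_of charFp) \in S].

Definition subspace_set (F : finFieldType) (p : nat)
    (charFp : p \in [pchar F]) (S : {subfield fieldExt_of charFp})
    (V : {vspace fieldOver S}) : {set F} :=
  [set x : F | (x : fieldOver S) \in V].

(* Main.v *)
(* For all xi in X one Balog-Szemeredi-Gowers argument, run on the bipartite
   graph between A and A x X, gives a single A' in A and a set Y of ratios of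
   elements of X, with 1 in Y, such that |A' - y A'| <= K^O(1) |A'| for y in Y.
   By Plunnecke-Ruzsa the same holds for quotients of short polynomial
   expressions in Y.  If Q = (Y - Y) / (Y - Y) were not closed under r |-> r + 1
   and r |-> y r, these expressions would fill the whole field because
   |Y|^4 > q; summing the energies E(A', xi A') over all xi then contradicts
   q^(1/2) << |A'| <= q^(2/3).  So Q is a subfield G of order at least |Y|, and
   q = |G|^d with d <= 3.
   Summing E(A', xi A') over xi in G shows that most differences of A' lie in
   directions v such that A' is essentially a union of lines parallel to G v.
   Independent directions of this kind can be added to A' at bounded cost, so
   that |A'| <= q^(2/3) leaves room for at most d - 1 of them, while
   |A'| >> q^(1/2) requires two.  Hence d = 3, these directions span a plane V
   over G, and some translate of V contains a large part of A'. *)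
Require Import Defs.
From mathcomp Require Import all_boot all_order all_algebra all_field.
From mathcomp Require Import ring lra zify.

Set Implicit Arguments.
Unset Strict Implicit.
Unset Printing Implicit Defensive.

Import Order.TTheory GRing.Theory Num.Theory.

Local Open Scope ring_scope.

(** * Sumset inequalities *)

(** Energy, rather than the size of a sumset, is carried along because it can be summed over
    dilates. Over the whole field the energies total at most [q |A'|^2 + |A'|^4], so they cannot all
    be large; over a subfield [G] they count pairs of [A'] on common lines parallel to [G v], which
    is how rich directions arise. All exponents descend from one loss,
    [|A' - y A'| <= O(K^19) |A'|]: each of two difference sets costs [K^8], the overlap of two
    neighbourhoods [K^2], the passage from [A] to [A'] one [K]. A quotient of differences of [Y]
    involves four dilates and costs [K^76]. Clearing denominators gives monomials of total degree
    48, which cost [K^912]. Three rich lines at [K^(3 * 76)] each cost [K^684]. As [|A'|] may reach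
    [q^(2/3)], the last two factors must stay below [q^(1/3)]; since [K^1504 << |X| < q^(1/2)],
    exponents up to [1504 * 2 / 3] are affordable. The plane loses [K^76] relative to [A'] and one
    more [K] relative to [A], within the allowed [K^85]. *)

Definition sumset (U : finZmodType) (A B : {set U}) : {set U} :=
  [set a + b | a in A, b in B].

Definition oppset (U : finZmodType) (A : {set U}) : {set U} := [set - a | a in A].

Section Sumsets.
Variable U : finZmodType.
Implicit Types (A B C S X Y : {set U}).

Lemma mem_sumset A B a b : a \in A -> b \in B -> a + b \in sumset A B.
Proof. exact: imset2_f. Qed.

Lemma mem_oppset A a : (a \in oppset A) = (- a \in A).
Proof.
apply/imsetP/idP => [[b bA ->]|aA]; first by rewrite opprK.
by exists (- a); rewrite ?opprK.
Qed.

Lemma oppsetK A : oppset (oppset A) = A.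
Proof. by apply/setP=> x; rewrite !mem_oppset opprK. Qed.

Lemma card_oppset A : #|oppset A| = #|A|.
Proof. exact: card_imset oppr_inj. Qed.

Lemma sumsetC A B : sumset A B = sumset B A.
Proof.
by apply/setP=> x; apply/imset2P/imset2P => -[a b aA bB ->];
  exists b a; rewrite // addrC.
Qed.

Lemma sumsetA A B C : sumset A (sumset B C) = sumset (sumset A B) C.
Proof.
apply/setP=> x; apply/imset2P/imset2P => [[a _ aA /imset2P[b c bB cC ->] ->]|].
  by exists (a + b) c; rewrite ?mem_sumset // addrA.
move=> [_ c /imset2P[a b aA bB ->] cC ->].
by exists a (b + c); rewrite ?mem_sumset // addrA.
Qed.

Lemma sumsetS A B C S : A \subset B -> C \subset S -> sumset A C \subset sumset B S.
Proof. exact: imset2S. Qed.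

Lemma sumset0 A : sumset A [set 0] = A.
Proof.
apply/setP=> x; apply/imset2P/idP => [[a b aA /set1P-> ->]|xA]; first by rewrite addr0.
by exists x 0; rewrite ?inE ?addr0.
Qed.

Lemma sumset_setU A B C : sumset A (B :|: C) = sumset A B :|: sumset A C.
Proof.
apply/setP=> x; rewrite inE; apply/imset2P/orP.
  by move=> [a b aA /setUP[bB|bC] ->]; [left|right]; rewrite mem_sumset.
by move=> [/imset2P[a b aA bB ->]|/imset2P[a b aA bB ->]]; exists a b;
  rewrite // inE bB ?orbT.
Qed.

Lemma sumset_set0 A : sumset A set0 = set0.
Proof. by apply/setP=> x; rewrite inE; apply/imset2P => -[a b _]; rewrite inE. Qed.

Lemma oppset_sumset A B : oppset (sumset A B) = sumset (oppset A) (oppset B).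
Proof.
apply/setP=> x; rewrite mem_oppset; apply/imset2P/imset2P.
  move=> [a b aA bB e]; exists (- a) (- b); rewrite ?mem_oppset ?opprK //.
  by rewrite -opprD -e opprK.
move=> [a b aA bB ->]; exists (- a) (- b); rewrite -?mem_oppset //.
by rewrite opprD.
Qed.

Lemma card_sumset1 A (b : U) : #|sumset A [set b]| = #|A|.
Proof.
rewrite -(card_imset (fun x => x \in A) (addIr b)).
congr #|pred_of_set _|; apply/setP=> x; apply/imset2P/imsetP.
  by move=> [a c aA /set1P-> ->]; exists a.
by move=> [a aA ->]; exists a b; rewrite ?inE.
Qed.

(** Fix for each [x] in [A + B] a summand [l x] in [A]. The map
    [(x, c) |-> (l x - c, c + (x - l x))] is injective: its coordinates add up to [x], and then the
    first one gives [c]. *)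
Lemma ruzsa_triangle A B C :
  (#|sumset A B| * #|C| <= #|sumset A (oppset C)| * #|sumset C B|)%N.
Proof.
pose l x := odflt 0 [pick a in A | x - a \in B].
have lP x : x \in sumset A B -> l x \in A /\ x - l x \in B.
  move=> /imset2P[a b aA bB xE]; rewrite /l; case: pickP => [y /andP[]//|].
  by move/(_ a); rewrite aA xE addrC addKr bB.
rewrite -!cardsX.
pose f (u : U * U) := (l u.1 - u.2, u.2 + (u.1 - l u.1)).
rewrite -(@card_in_imset _ _ f).
  apply/subset_leq_card/subsetP => _ /imsetP[[x c] /setXP[/= /lP[lA lB] cC] ->].
  by rewrite inE /= !mem_sumset // mem_oppset opprK.
move=> [x c] [y d] _ _ [/= e1 e2].
have exy : x = y.
  have sumE (a b z : U) : (b - z) + (z + (a - b)) = a.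
    by rewrite addrA subrK addrC subrK.
  by rewrite -(sumE x (l x) c) e1 e2 sumE.
by move: e1; rewrite exy => /addrI/oppr_inj ->.
Qed.

(* Petridis' induction on C: adding c to C costs |X + S| minus the part of
   X + S + c already covered, and the covered part is controlled by the
   minimality of |X + S| / |X| among nonempty subsets of X. *)
Lemma petridis X S C :
  (forall Z : {set U}, Z \subset X -> #|sumset X S| * #|Z| <= #|sumset Z S| * #|X|)%N ->
  (#|X| * #|sumset (sumset X S) C| <= #|sumset X S| * #|sumset X C|)%N.
Proof.
move=> Xmin; have [m] := ubnP #|C|; elim: m C => // m IH C leCm.
have [->|[c cC]] := set_0Vmem C; first by rewrite !sumset_set0 cards0 !muln0.
pose C' := C :\ c.
have CE : C = C' :|: [set c] by rewrite setUC setD1K.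
have {IH} IH : (#|X| * #|sumset (sumset X S) C'| <= #|sumset X S| * #|sumset X C'|)%N.
  by apply: IH; move: leCm; rewrite (cardsD1 c) cC.
pose Z := [set x in X | x + c \in sumset X C'].
have sZX : Z \subset X by apply/subsetP=> x; rewrite inE => /andP[].
have cardX : (#|sumset X C'| + #|X| <= #|sumset X C| + #|Z|)%N.
  rewrite -(card_sumset1 X c) -(card_sumset1 Z c) -cardsUI CE sumset_setU.
  rewrite leq_add2l; apply/subset_leq_card/subsetP=> x.
  rewrite inE => /andP[xC /imset2P[a _ aX /set1P-> xE]].
  by rewrite xE mem_sumset ?inE // aX -xE.
have cardXS : (#|sumset (sumset X S) C| + #|sumset Z S|
               <= #|sumset (sumset X S) C'| + #|sumset X S|)%N.
  rewrite -(card_sumset1 (sumset X S) c) -(card_sumset1 (sumset Z S) c).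
  rewrite -[leqRHS]cardsUI CE sumset_setU leq_add2l.
  apply/subset_leq_card; rewrite subsetI; apply/andP; split.
    apply/subsetP=> _ /imset2P[_ _ /imset2P[a s aZ sS ->] /set1P-> ->].
    move: aZ; rewrite inE => /andP[aX /imset2P[b d bX dC' e]].
    by rewrite addrAC e addrAC mem_sumset // mem_sumset.
  by rewrite sumsetS // sumsetS.
have := Xmin Z sZX; nia.
Qed.

(* A minimiser X of |X + S| / |X| serves all h simultaneously. *)
Lemma plunnecke (R : realFieldType) (alpha : R) A S :
  A != set0 -> #|sumset A S|%:R <= alpha * #|A|%:R ->
  exists X : {set U}, [/\ X \subset A, X != set0 &
    forall h, #|sumset X (iter h (sumset S) [set 0])|%:R <= alpha ^+ h * #|X|%:R].
Proof.
move=> An0 AS.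
pose P (X : {set U}) := (X \subset A) && (X != set0).
have PA : P A by rewrite /P subxx.
pose rat (X : {set U}) : R := #|sumset X S|%:R / #|X|%:R.
have cpos (X : {set U}) : X != set0 -> 0 < #|X|%:R :> R by rewrite ltr0n card_gt0.
case: (arg_minP rat PA) => X /andP[sXA Xn0] Xmin.
exists X; split=> //.
have Xmin' (Z : {set U}) : Z \subset X -> (#|sumset X S| * #|Z| <= #|sumset Z S| * #|X|)%N.
  move=> sZX; have [->|Zn0] := eqVneq Z set0; first by rewrite cards0 muln0.
  have := Xmin Z; rewrite /P Zn0 (subset_trans sZX sXA) => /(_ isT).
  by rewrite /rat ler_pdivrMr ?cpos // mulrAC ler_pdivlMr ?cpos // -!natrM ler_nat.
have rX : rat X <= alpha.
  by apply: le_trans (Xmin A PA) _; rewrite /rat ler_pdivrMr ?cpos.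
elim=> [|h IH]; first by rewrite sumset0 mul1r.
have := petridis (iter h (sumset S) [set 0]) Xmin'.
rewrite -sumsetA -(ler_nat R) !natrM iterS => le1.
rewrite exprS -mulrA; apply: le_trans (_ : rat X * (alpha ^+ h * #|X|%:R) <= _).
  apply: le_trans (_ : rat X * #|sumset X (iter h (sumset S) [set 0])|%:R <= _).
    by rewrite /rat mulrAC ler_pdivlMr ?cpos // mulrC.
  by rewrite ler_wpM2l // divr_ge0.
by rewrite ler_wpM2r // mulr_ge0 // exprn_ge0 // (le_trans _ rX) // divr_ge0.
Qed.

Definition sumsets (s : seq {set U}) : {set U} := foldr (@sumset U) [set 0] s.

Lemma sumsets_cat s t : sumsets (s ++ t) = sumset (sumsets s) (sumsets t).
Proof.
elim: s => [|B s IH] /=; first by rewrite sumsetC sumset0.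
by rewrite IH sumsetA.
Qed.

Lemma sumsets_sub s S : {in s, forall B : {set U}, B \subset S} ->
  sumsets s \subset iter (size s) (sumset S) [set 0].
Proof.
elim: s => [|B s IH] //= sS; apply: sumsetS; first by rewrite sS ?mem_head.
by apply: IH => C Cs; rewrite sS ?inE ?Cs ?orbT.
Qed.

(** Plunnecke's inequality concerns iterated sums of a single set. The union of all summands is such
    a set, at the price of the factor [size s]. *)
Lemma card_sumset_bigcup (R : realFieldType) (alpha : R) A (s : seq {set U}) :
  {in s, forall B, #|sumset A B|%:R <= alpha * #|A|%:R} ->
  #|sumset A (\bigcup_(B <- s) B)|%:R <= (size s)%:R * alpha * #|A|%:R.
Proof.
elim: s => [|B s IH] sS; first by rewrite big_nil sumset_set0 cards0 !mul0r.
have le1 := sS B (mem_head _ _).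
have le2 := IH (fun C Cs => sS C (@mem_behead _ (B :: s) C Cs)).
rewrite big_cons sumset_setU [size _]/= -addn1 natrD mulrDl mul1r mulrDl addrC.
apply: le_trans (lerD le1 le2); rewrite -natrD ler_nat.
by rewrite cardsU leq_subr.
Qed.

(* The triangle inequality through the common subset X supplied by
   [plunnecke] makes the signs of the summands irrelevant. *)
Lemma card_sumsets (R : realFieldType) (alpha : R) A (s t : seq {set U}) :
  A != set0 -> {in s ++ t, forall B, #|sumset A B|%:R <= alpha * #|A|%:R} ->
  #|sumset (sumsets s) (oppset (sumsets t))|%:R
    <= ((size s + size t)%:R * alpha) ^+ (size s + size t) * #|A|%:R.
Proof.
move=> An0 Ast.
have /(plunnecke An0)[X [sXA Xn0 XS]] := card_sumset_bigcup Ast.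
set S := \bigcup_(B <- _) B in XS *; rewrite size_cat in XS.
have sub r : {subset r <= s ++ t} ->
    #|sumset X (sumsets r)|%:R <= ((size s + size t)%:R * alpha) ^+ size r * #|X|%:R.
  move=> rst; apply: le_trans (XS (size r)); rewrite ler_nat.
  apply/subset_leq_card/sumsetS => //; apply: sumsets_sub => B /rst Bst.
  by rewrite /S (big_rem B Bst) /= subsetUl.
have {}XS := sub.
have tri := ruzsa_triangle (sumsets s) (oppset (sumsets t)) (oppset X).
rewrite oppsetK -oppset_sumset !card_oppset -(ler_nat R) !natrM in tri.
have le1 := XS s; have le2 := XS t.
have Xpos : 0 < #|X|%:R :> R by rewrite ltr0n card_gt0.
rewrite -(ler_pM2r Xpos); apply: le_trans tri _.
rewrite sumsetC.
apply: le_trans (ler_pM _ _ (le1 _) (le2 _)) _ => //.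
- by move=> B Bs; rewrite mem_cat Bs.
- by move=> B Bs; rewrite mem_cat Bs orbT.
rewrite mulrACA -exprD -mulrA ler_wpM2l ?ler_wpM2r ?ler_nat ?subset_leq_card //.
(* [alpha >= 0] is read off from the bound for any one summand; if there is none, the power has
   exponent 0. *)
have [x0 Ax0] := set0Pn _ An0.
case: (s ++ t) Ast (size_cat s t) => [_ /esym/eqP|B r Ast _].
  by rewrite addn_eq0 => /andP[/eqP-> /eqP->].
rewrite exprn_ge0 // mulr_ge0 // -(pmulr_lge0 alpha (_ : 0 < #|A|%:R)).
  by apply: le_trans (Ast B (mem_head _ _)).
by rewrite ltr0n card_gt0.
Qed.
End Sumsets.

(** * Dilates and energy *)

Lemma card_set_pair (S T : finType) (p : S -> T -> bool) :
  #|[set u : S * T | p u.1 u.2]| = (\sum_x #|[set y | p x y]|)%N.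
Proof.
rewrite -sum1_card (eq_bigl (fun u : S * T => p u.1 u.2)); last by move=> u; rewrite inE.
rewrite -(pair_big_dep xpredT (fun x y => p x y) (fun _ _ => 1%N)) /=.
by apply: eq_bigr => x _; rewrite -sum1_card; apply: eq_bigl => y; rewrite inE.
Qed.

(** Cauchy-Schwarz against the constant 1, from the nonnegativity of the variance of [f] about its
    mean [S / c]. *)
Lemma sqr_sum_le (R : realFieldType) (I : finType) (P : {set I}) (f : I -> R) :
  (\sum_(i in P) f i) ^+ 2 <= #|P|%:R * \sum_(i in P) f i ^+ 2.
Proof.
have [->|Pn0] := eqVneq P set0; first by rewrite !big_set0 cards0 mul0r expr0n.
have c0 : 0 < #|P|%:R :> R by rewrite ltr0n card_gt0.
set c : R := #|P|%:R in c0 *; set S := \sum_(i in P) f i.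
have : 0 <= \sum_(i in P) (f i - S / c) ^+ 2 by apply: sumr_ge0 => i _; apply: sqr_ge0.
have -> : \sum_(i in P) (f i - S / c) ^+ 2 =
    (\sum_(i in P) f i ^+ 2) - S ^+ 2 / c.
  rewrite (eq_bigr (fun i => (f i ^+ 2 + f i * (- (2 * (S / c)))) + (S / c) ^+ 2)).
    rewrite !big_split /= -mulr_suml sumr_const -[_ *+ #|P|]mulr_natr -/c -/S.
    by field; rewrite gt_eqF.
  by move=> i _; ring.
by rewrite subr_ge0 ler_pdivrMr // mulrC.
Qed.

Lemma card_fibres (S T : finType) (f : S -> T) (P : {set S}) :
  (\sum_(y in f @: P) #|[set x in P | f x == y]| = #|P|)%N.
Proof.
rewrite -[in RHS]sum1_card (partition_big f [in f @: P]) /=; last first.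
  by move=> x; apply: imset_f.
by apply: eq_bigr => y _; rewrite -sum1_card; apply: eq_bigl => x; rewrite inE.
Qed.

Lemma card_collisions (S T : finType) (f : S -> T) (P : {set S}) :
  #|[set u : S * S | [&& u.1 \in P, u.2 \in P & f u.1 == f u.2]]|
    = (\sum_(y in f @: P) #|[set x in P | f x == y]| ^ 2)%N.
Proof.
rewrite (card_set_pair (fun x x' => [&& x \in P, x' \in P & f x == f x'])).
rewrite (bigID [in P]) /= addnC big1 ?add0n; last first.
  by move=> x /negPf xP; apply: eq_card0 => y; rewrite !inE xP.
rewrite (partition_big f [in f @: P]) /=; last by move=> x; apply: imset_f.
apply: eq_bigr => y _; rewrite expnS expn1 -sum_nat_const.
apply: eq_big => [x|x /andP[xP /eqP <-]]; first by rewrite inE.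
by apply: eq_card => z; rewrite !inE xP eq_sym.
Qed.

Lemma card_collisions_ge (S T : finType) (f : S -> T) (P : {set S}) :
  (#|P| ^ 2 <= #|f @: P| *
    #|[set u : S * S | [&& u.1 \in P, u.2 \in P & f u.1 == f u.2]]|)%N.
Proof.
rewrite card_collisions -(ler_nat rat) natrX natrM natr_sum.
under [X in _ * X]eq_bigr do rewrite natrX.
by rewrite -(card_fibres f P) natr_sum; apply: sqr_sum_le.
Qed.

Definition dilate (F : finFieldType) (c : F) (A : {set F}) : {set F} :=
  [set c * a | a in A].

Section Dilates.
Variable F : finFieldType.
Implicit Types (A B G : {set F}) (c d x y xi : F).

Lemma mem_dilate A c a : a \in A -> c * a \in dilate c A.
Proof. exact: imset_f. Qed.

Lemma card_dilate A c : c != 0 -> #|dilate c A| = #|A|.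
Proof. by move=> c0; apply: card_imset; apply: mulfI. Qed.

Lemma dilateM A c d : dilate c (dilate d A) = dilate (c * d) A.
Proof. by rewrite /dilate -imset_comp; apply: eq_imset => a /=; rewrite mulrA. Qed.

Lemma dilate1 A : dilate 1 A = A.
Proof. by rewrite /dilate (eq_imset _ (@mul1r _)) imset_id. Qed.

Lemma dilate_sumset A B c : dilate c (sumset A B) = sumset (dilate c A) (dilate c B).
Proof.
apply/setP=> x; apply/imsetP/imset2P.
  move=> [_ /imset2P[a b aA bB ->] ->].
  by exists (c * a) (c * b); rewrite ?mem_dilate // mulrDr.
move=> [_ _ /imsetP[a aA ->] /imsetP[b bB ->] ->].
by exists (a + b); rewrite ?mem_sumset // mulrDr.
Qed.

Lemma dilate_oppset A c : dilate c (oppset A) = oppset (dilate c A).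
Proof.
by rewrite /dilate /oppset -!imset_comp; apply: eq_imset => a /=; rewrite mulrN.
Qed.

Lemma dilate0_sub A : dilate 0 A \subset [set 0].
Proof. by apply/subsetP=> _ /imsetP[a _ ->]; rewrite mul0r inE. Qed.

(** The equation reads both [a1 + xi a4 = a2 + xi a3] and [a1 - xi a3 = a2 - xi a4], so the energy
    counts collisions of the sum map and of the difference map. The first form gives lower bounds
    from a small [A + xi A], the second serves the popular differences. *)
Lemma card_energy_add A xi : energy_dilate A xi =
  #|[set u : (F * F) * (F * F) | [&& u.1 \in setX A A, u.2 \in setX A A &
      u.1.1 + xi * u.1.2 == u.2.1 + xi * u.2.2]]|.
Proof.
pose g (t : F * F * F * F) : (F * F) * (F * F) :=
  let: (a1, a2, a3, a4) := t in ((a1, a4), (a2, a3)).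
have gbij : bijective g.
  exists (fun u : (F * F) * (F * F) => (u.1.1, u.2.1, u.2.2, u.1.2)).
    by case=> [[[]]].
  by case=> [[] ? ? []].
rewrite -(on_card_preimset (onW_bij _ gbij)).
apply: eq_card => -[[[a1 a2] a3] a4]; rewrite !inE /=.
have -> : (a1 - a2 == xi * (a3 - a4)) = (a1 + xi * a4 == a2 + xi * a3).
  rewrite -subr_eq0 -[RHS]subr_eq0; congr (_ == 0); ring.
by case: (a1 \in A) (a2 \in A) (a3 \in A) (a4 \in A) => [] [] [] [].
Qed.

Lemma card_energy_sub A xi : energy_dilate A xi =
  #|[set u : (F * F) * (F * F) | [&& u.1 \in setX A A, u.2 \in setX A A &
      u.1.1 - xi * u.1.2 == u.2.1 - xi * u.2.2]]|.
Proof.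
pose g (t : F * F * F * F) : (F * F) * (F * F) :=
  let: (a1, a2, a3, a4) := t in ((a1, a3), (a2, a4)).
have gbij : bijective g.
  exists (fun u : (F * F) * (F * F) => (u.1.1, u.2.1, u.1.2, u.2.2)).
    by case=> [[[]]].
  by case=> [[] ? ? []].
rewrite -(on_card_preimset (onW_bij _ gbij)).
apply: eq_card => -[[[a1 a2] a3] a4]; rewrite !inE /=.
have -> : (a1 - a2 == xi * (a3 - a4)) = (a1 - xi * a3 == a2 - xi * a4).
  rewrite -subr_eq0 -[RHS]subr_eq0; congr (_ == 0); ring.
by case: (a1 \in A) (a2 \in A) (a3 \in A) (a4 \in A) => [] [] [] [].
Qed.

Lemma energy_dilate_ge A xi :
  (#|A| ^ 4 <= #|sumset A (dilate xi A)| * energy_dilate A xi)%N.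
Proof.
rewrite card_energy_add.
have := card_collisions_ge (fun u : F * F => u.1 + xi * u.2) (setX A A).
rewrite cardsX mulnn -expnM.
move/leq_trans; apply; rewrite leq_mul2r; apply/orP; right.
apply/subset_leq_card/subsetP=> _ /imsetP[[a b] /setXP[/= aA bA] ->].
by rewrite mem_sumset ?mem_dilate.
Qed.

Lemma card_sumset_dilate_div A c d : d != 0 ->
  #|sumset A (dilate (c / d) A)| = #|sumset (dilate c A) (dilate d A)|.
Proof.
move=> d0; rewrite -(card_dilate _ d0) dilate_sumset dilateM sumsetC.
by rewrite mulrC divfK.
Qed.

Variable R : realFieldType.
Implicit Type kappa : R.

Definition dilate_bounded kappa A x :=
  #|sumset A (oppset (dilate x A))|%:R <= kappa * #|A|%:R.

(** Makes it free to adjoin 0 to the multipliers [Y]; with 0 and 1 in [Y], the quotient set contains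
    [Y]. *)
Lemma dilate_bounded0 kappa A : 1 <= kappa -> dilate_bounded kappa A 0.
Proof.
move=> k1; apply: (le_trans _ (ler_wpM2r _ k1)) => //; rewrite mul1r ler_nat.
rewrite -[leqRHS](card_sumset1 A 0); apply/subset_leq_card/sumsetS => //.
by apply/subsetP=> x; rewrite mem_oppset => /(subsetP (dilate0_sub A)); rewrite !inE oppr_eq0.
Qed.

(** Ruzsa's triangle inequality through [x A], as [x A - x y A] is a dilate of [A - y A]. Monomials
    of degree [j] in bounded multipliers thus cost [kappa ^+ j]. The case [x = 0] is separate
    because [x A] then collapses. *)
Lemma dilate_boundedM kappa kappa' A x y : 1 <= kappa -> 1 <= kappa' ->
  dilate_bounded kappa A x -> dilate_bounded kappa' A y ->
  dilate_bounded (kappa * kappa') A (x * y).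
Proof.
move=> k1 k1' Ax Ay; have [->|x0] := eqVneq x 0.
  by rewrite mul0r; apply: dilate_bounded0; rewrite mulr_ege1.
have [->|An0] := eqVneq A set0.
  by rewrite /dilate_bounded sumsetC sumset_set0 cards0 mulr0.
have Apos : 0 < #|A|%:R :> R by rewrite ltr0n card_gt0.
have := ruzsa_triangle A (oppset (dilate (x * y) A)) (dilate x A).
rewrite -dilateM -[X in sumset (dilate x A) X]dilate_oppset -dilate_sumset.
rewrite !card_dilate // -(ler_nat R) !natrM => tri.
rewrite /dilate_bounded -dilateM -(ler_pM2r Apos); apply: le_trans tri _.
rewrite (_ : kappa * kappa' * _ * _ = (kappa * #|A|%:R) * (kappa' * #|A|%:R)).
  exact: ler_pM.
by ring.
Qed.

Lemma mem_sumsets_dilate A a (s : seq F) : a \in A ->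
  - ((\sum_(x <- s) x) * a) \in sumsets [seq oppset (dilate x A) | x <- s].
Proof.
move=> aA; elim: s => [|x s IH] /=; first by rewrite big_nil mul0r oppr0 inE.
by rewrite big_cons mulrDl opprD mem_sumset // mem_oppset opprK mem_dilate.
Qed.

(** Since [A - x A] is what is bounded, the blocks given to [card_sumsets] are the sets [- x A]:
    negative terms go to its added list and positive terms to its subtracted list. *)
Lemma card_dilate_comb kappa A (s1 s2 t1 t2 : seq F) (n := size (s1 ++ s2 ++ t1 ++ t2)) :
  A != set0 -> {in s1 ++ s2 ++ t1 ++ t2, forall x, dilate_bounded kappa A x} ->
  #|sumset (dilate (\sum_(x <- s1) x - \sum_(x <- s2) x) A)
           (dilate (\sum_(x <- t1) x - \sum_(x <- t2) x) A)|%:R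
    <= (n%:R * kappa) ^+ n * #|A|%:R.
Proof.
move=> An0 Ast.
pose D := fun x => oppset (dilate x A).
have := @card_sumsets F R kappa A (map D s2 ++ map D t2) (map D s1 ++ map D t1) An0.
have -> : (size (map D s2 ++ map D t2) + size (map D s1 ++ map D t1) = n)%N.
  by rewrite /n !size_cat !size_map; lia.
move=> bound; apply: (le_trans _ (bound _)); last first.
  move=> B; rewrite -!map_cat => /mapP[x xs ->]; apply: Ast; move: xs.
  by rewrite !mem_cat => /orP[/orP[]|/orP[]] ->; rewrite ?orbT.
rewrite ler_nat; apply/subset_leq_card/subsetP.
move=> _ /imset2P[_ _ /imsetP[a aA ->] /imsetP[b bA ->] ->].
rewrite !mulrBl.
have -> (u v w z : F) : u - v + (w - z) = (- v - z) + (u + w) by ring.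
apply: mem_sumset; last rewrite mem_oppset opprD;
  by rewrite sumsets_cat mem_sumset // mem_sumsets_dilate.
Qed.

(** A small [c A + d A] is, after division by [d], a small [A + (c / d) A], and by Cauchy-Schwarz a
    small sumset forces many collisions. *)
Lemma energy_dilate_comb kappa A (s1 s2 t1 t2 : seq F)
    (n := size (s1 ++ s2 ++ t1 ++ t2)) :
  A != set0 -> {in s1 ++ s2 ++ t1 ++ t2, forall x, dilate_bounded kappa A x} ->
  \sum_(x <- t1) x - \sum_(x <- t2) x != 0 ->
  #|A|%:R ^+ 3 <= (n%:R * kappa) ^+ n *
    (energy_dilate A ((\sum_(x <- s1) x - \sum_(x <- s2) x) /
                      (\sum_(x <- t1) x - \sum_(x <- t2) x)))%:R.
Proof.
move=> An0 Ast d0; have := card_dilate_comb An0 Ast.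
rewrite -card_sumset_dilate_div // -/n => bound.
have := energy_dilate_ge A ((\sum_(x <- s1) x - \sum_(x <- s2) x) /
                      (\sum_(x <- t1) x - \sum_(x <- t2) x)).
rewrite -(ler_nat R) natrM natrX => /le_trans /(_ (ler_wpM2r _ bound)) => le1.
have Apos : 0 < #|A|%:R :> R by rewrite ltr0n card_gt0.
rewrite -(ler_pM2r Apos) -exprSr (le_trans (le1 _)) //.
by rewrite mulrAC.
Qed.

End Dilates.

(** * Rich directions *)

(** The popularity principle: if the sum is at least twice [level * #|P|], the terms above [level]
    carry half of it and must be numerous. *)
Lemma sum_le_large (R : realFieldType) (I : finType) (P : {set I}) (f : I -> R)
    (bound level : R) :
  0 <= level ->
  {in P, forall i, f i <= bound} ->
  \sum_(i in P) f i <= bound * #|[set i in P | level <= f i]|%:R + level * #|P|%:R.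
Proof.
move=> l0 fb; rewrite (bigID (fun i => level <= f i)) /=; apply: lerD.
  rewrite mulr_natr -sumr_const [leRHS](eq_bigl (fun i => (i \in P) && (level <= f i))).
    by apply: ler_sum => i /andP[/fb].
  by move=> i; rewrite inE.
apply: le_trans (_ : \sum_(i in P | ~~ (level <= f i)) level <= _).
  by apply: ler_sum => i /andP[_]; rewrite -ltNge => /ltW.
rewrite -big_filter_cond /= mulr_natr -sumr_const [leRHS](bigID (fun i => level <= f i)) /=.
rewrite big_filter_cond lerDr; exact: sumr_ge0.
Qed.

Section CosetConcentration.
Variables (U : finZmodType) (R : realFieldType).
Implicit Types (A W : {set U}) (kappa : R).

(* If many differences of A lie in the subgroup W, then a large part of A is
   covered by few cosets of W; small doubling transfers this to all of A. *)
Lemma card_sumset_subgroup kappa A W :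
  0 < kappa -> A != set0 -> 0 \in W -> {in W &, forall x y, x - y \in W} ->
  #|sumset A (oppset A)|%:R <= kappa * #|A|%:R ->
  #|W|%:R * #|A|%:R <= 4 * kappa *
    #|[set w in setX A A | w.1 - w.2 \in W]|%:R ->
  #|sumset A W|%:R <= 64 * kappa ^+ 3 * #|A|%:R.
Proof.
move=> k0 An0 W0 WB AA rich.
have WN x : x \in W -> - x \in W by move=> xW; rewrite -sub0r WB.
have WD x y : x \in W -> y \in W -> x + y \in W.
  by move=> xW yW; rewrite -[y]opprK WB // WN.
pose c x := #|[set a in A | a - x \in W]|.
have cE x w : w \in W -> c (x + w) = c x.
  move=> wW; apply: eq_card => a; rewrite !inE; congr (_ && _).
  apply/idP/idP => [|axW]; last by rewrite opprD addrA WB.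
  by move/WD/(_ wW); rewrite opprD addrA subrK.
have card_coset x : #|[set y | y - x \in W]| = #|W|.
  rewrite -(card_sumset1 W x); apply: eq_card => y; rewrite inE.
  apply/idP/imset2P => [yW|[w _ wW /set1P-> ->]]; last by rewrite addrK.
  by exists (y - x) x; rewrite ?inE // subrK.
have cW x : (c x <= #|W|)%N.
  rewrite -(card_coset x); apply/subset_leq_card/subsetP => a.
  by rewrite !inE => /andP[].
have NE : #|[set w in setX A A | w.1 - w.2 \in W]| = (\sum_(a in A) c a)%N.
  rewrite (eq_card (B := [set u : U * U | (u.1 \in A) && ((u.2 \in A) && (u.1 - u.2 \in W))])).
    rewrite (card_set_pair (fun x y => (x \in A) && ((y \in A) && (x - y \in W)))).
    rewrite [RHS]big_mkcond; apply: eq_bigr => x _; case: ifP => xA.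
      apply: eq_card => y; rewrite !inE /=; congr (_ && _).
      by apply/idP/idP => /WN; rewrite opprB.
    by apply: eq_card0 => y; rewrite !inE.
  by move=> [x y]; rewrite !inE /= andbA.
have sumc : (\sum_x c x = #|A| * #|W|)%N.
  rewrite -(card_set_pair (fun x a => (a \in A) && (a - x \in W))).
  pose g (u : U * U) := (u.2, u.1).
  have gb : bijective g by exists g => -[].
  rewrite -(on_card_preimset (onW_bij _ gb)).
  rewrite (eq_card (B := [set u : U * U | (u.1 \in A) && (u.1 - u.2 \in W)])); last first.
    by move=> [x y]; rewrite !inE.
  rewrite (card_set_pair (fun a x => (a \in A) && (a - x \in W))).
  rewrite -sum_nat_const [RHS]big_mkcond; apply: eq_bigr => a _; case: ifP => aA.
    rewrite -(card_coset a); apply: eq_card => y; rewrite !inE.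
    by apply/idP/idP => /WN; rewrite opprB.
  by apply: eq_card0 => y; rewrite !inE.
have Wpos : 0 < #|W|%:R :> R by rewrite ltr0n card_gt0; apply/set0Pn; exists 0.
have Apos : 0 < #|A|%:R :> R by rewrite ltr0n card_gt0.
(* Chosen so that elements with a sparse coset account for at most half of the pairs given by
   [rich]. *)
pose level : R := #|W|%:R / (8 * kappa).
have k8 : 0 < 8 * kappa by rewrite mulr_gt0.
have l0 : 0 < level by rewrite divr_gt0.
pose B := [set a in A | level <= (c a)%:R].
have sBA : B \subset A by apply/subsetP=> a; rewrite inE => /andP[].
have Bbig : #|A|%:R <= 8 * kappa * #|B|%:R.
  have cle : {in A, forall a, (c a)%:R <= #|W|%:R :> R} by move=> a _; rewrite ler_nat.
  have := sum_le_large (ltW l0) cle; rewrite -natr_sum -NE -/B => le1.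
  have k4 : 0 <= 4 * kappa by rewrite mulr_ge0 // ltW.
  move: rich => /le_trans /(_ (ler_wpM2l k4 le1)).
  rewrite mulrDr.
  have -> : 4 * kappa * (level * #|A|%:R) = #|W|%:R * #|A|%:R / 2.
    by rewrite /level; field; rewrite gt_eqF.
  move=> h; rewrite -(ler_pM2l Wpos); lra.
(* [c] is constant on cosets of [W], hence at least [level] on all of [B + W], while its total over
   the group is [|A| |W|]. *)
have BWsmall : #|sumset B W|%:R <= 8 * kappa * #|A|%:R.
  have : level * #|sumset B W|%:R <= #|A|%:R * #|W|%:R.
    rewrite -natrM -sumc natr_sum mulr_natr -sumr_const big_mkcond /=.
    apply: ler_sum => x _; case: ifP => // /imset2P[a w]; rewrite inE => /andP[_ ca] wW ->.
    by rewrite cE.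
  rewrite /level mulrAC ler_pdivrMr // => h.
  by rewrite -(ler_pM2l Wpos); lra.
have AB : #|sumset A (oppset B)|%:R <= kappa * #|A|%:R.
  apply: le_trans AA; rewrite ler_nat; apply/subset_leq_card/sumsetS => //.
  by apply/subsetP=> x; rewrite !mem_oppset; apply: (subsetP sBA).
have := ruzsa_triangle A W B; rewrite -(ler_nat R) !natrM => tri.
have le2 := le_trans tri (ler_pM (ler0n _ _) (ler0n _ _) AB BWsmall).
rewrite -(ler_pM2r Apos).
have : #|sumset A W|%:R * #|A|%:R <= 8 * kappa * (#|sumset A W|%:R * #|B|%:R).
  by rewrite [leRHS]mulrCA ler_wpM2l.
move/le_trans; apply.
have -> : 64 * kappa ^+ 3 * #|A|%:R * #|A|%:R =
   8 * kappa * (kappa * #|A|%:R * (8 * kappa * #|A|%:R)) by ring.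
by rewrite ler_pM2l.
Qed.

End CosetConcentration.

Section EnergySum.
Variable F : finFieldType.
Implicit Types (A G : {set F}).

Definition line_pairs A G (v : F) : {set F * F} :=
  [set w in setX A A | w.1 - w.2 \in dilate v G].

Lemma energy_dilate_sum A xi : (energy_dilate A xi =
  \sum_(u in setX A A) #|[set w in setX A A | (w.1 - w.2 == xi * (u.1 - u.2))%R]|)%N.
Proof.
pose g (t : F * F * F * F) : (F * F) * (F * F) :=
  let: (a1, a2, a3, a4) := t in ((a3, a4), (a1, a2)).
have gbij : bijective g.
  exists (fun u : (F * F) * (F * F) => (u.2.1, u.2.2, u.1.1, u.1.2)).
    by case=> [[[]]].
  by case=> [[] ? ? []].
pose p (u w : F * F) := (u \in setX A A) && ((w \in setX A A) && (w.1 - w.2 == xi * (u.1 - u.2))).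
transitivity #|[set u : (F * F) * (F * F) | p u.1 u.2]|.
  rewrite -(on_card_preimset (onW_bij _ gbij)).
  apply: eq_card => -[[[a1 a2] a3] a4]; rewrite !inE /p !inE /=.
  by case: (a1 \in A) (a2 \in A) (a3 \in A) (a4 \in A) => [] [] [] [].
rewrite card_set_pair [RHS]big_mkcond; apply: eq_bigr => u _.
rewrite /p; case: ifP => uA; last by apply: eq_card0 => w; rewrite !inE.
by apply: eq_card => w; rewrite !inE.
Qed.

Lemma card_line_pairs A G v : (#|line_pairs A G v| <= #|G| * #|A|)%N.
Proof.
pose h (w : F * F) := (w.1 - w.2, w.2).
have hinj : injective h by move=> [a b] [c d] [] e1 e2; move: e1; rewrite /= e2 => /addIr ->.
rewrite -(card_imset _ hinj).
apply: leq_trans (_ : #|setX (dilate v G) A| <= _)%N.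
  apply/subset_leq_card/subsetP => _ /imsetP[[a b]] /[!inE] /= /andP[/andP[aA bA] abW] ->.
  by rewrite /= bA abW.
by rewrite cardsX leq_mul2r leq_imset_card orbT.
Qed.

(** Fix [u = (a3, a4)]. If [a3 = a4], each [xi] leaves only [a1 = a2], which gives the first term.
    Otherwise distinct [xi] in [G] give distinct values of [a1 - a2], all in [(a3 - a4) G], so each
    pair on such a line is counted at most once. *)
Lemma energy_sum_le A G :
  (\sum_(xi in G) energy_dilate A xi <= #|G| * #|A| ^ 2 +
    \sum_(u in setX A A | u.1 != u.2) #|line_pairs A G (u.1 - u.2)%R|)%N.
Proof.
under eq_bigr do rewrite energy_dilate_sum.
rewrite exchange_big /= (bigID (fun u : F * F => u.1 == u.2)) /=; apply: leq_add.
  apply: leq_trans (_ : \sum_(u in [set (a, a) | a in A]) #|G| * #|A| <= _)%N; last first.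
    rewrite sum_nat_const; apply: leq_trans (leq_mul (leq_imset_card _ _) (leqnn _)) _.
    by rewrite mulnCA mulnn.
  rewrite big_mkcond [leqRHS]big_mkcond; apply: leq_sum => -[a b] _ /=.
  case: ifP => // /andP[]; rewrite inE /= => /andP[aA _] /eqP <-.
  rewrite imset_f // -sum_nat_const; apply: leq_sum => xi _.
  rewrite subrr mulr0; apply: leq_trans (leq_imset_card (fun a => (a, a)) A).
  apply/subset_leq_card/subsetP=> -[x y] /[!inE] /= /andP[/andP[xA yA]].
  by rewrite subr_eq0 => /eqP->; rewrite imset_f.
apply: leq_sum => u /andP[_ u12]; set v := u.1 - u.2.
have v0 : v != 0 by rewrite subr_eq0.
rewrite -sum1_card /line_pairs.
under eq_bigr do rewrite -sum1_card.
rewrite (exchange_big_dep [in line_pairs A G v]) /=; last first.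
  by move=> xi w xiG; rewrite !inE => /andP[-> /eqP->]; rewrite mulrC mem_dilate.
apply: leq_sum => w; rewrite inE => /andP[wA wv].
rewrite sum1_card.
have [xi0 xi0G wE] := imsetP wv.
apply: leq_trans (_ : #|[set xi0]| <= 1)%N; last by rewrite cards1.
apply/subset_leq_card/subsetP => xi; rewrite unfold_in /= !inE => /andP[_ /andP[_ /eqP e]].
by apply/eqP/(mulIf v0); rewrite -e wE mulrC.
Qed.

Variable R : realFieldType.
Implicit Type kappa : R.

(** Summation over all [xi] gives [q m^3 <= kappa (q m^2 + m^4)]. If both alternatives fail, each
    term on the right is less than half of the left side. *)
Lemma energy_all kappa A : 0 < kappa -> A != set0 ->
  (forall xi : F, #|A|%:R ^+ 3 <= kappa * (energy_dilate A xi)%:R) ->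
  #|F|%:R <= 2 * kappa * #|A|%:R \/ #|A|%:R <= 2 * kappa.
Proof.
move=> k0 An0 EA.
have Apos : 0 < #|A|%:R :> R by rewrite ltr0n card_gt0.
have := energy_sum_le A [set: F]; rewrite -(ler_nat R) natrD natr_sum cardsT.
rewrite natrM natrX => le1.
have le2 : (\sum_(u in setX A A | (u.1 != u.2)%R) #|line_pairs A setT (u.1 - u.2)%R| <= #|A| ^ 4)%N.
  apply: leq_trans (_ : \sum_(u in setX A A) #|A| ^ 2 <= _)%N; last first.
    by rewrite sum_nat_const cardsX mulnn -expnD.
  rewrite big_mkcondr; apply: leq_sum => u _; case: ifP => // _.
  rewrite -mulnn -cardsX; apply/subset_leq_card/subsetP => w.
  by rewrite inE => /andP[].
have le3 : #|F|%:R * #|A|%:R ^+ 3 <= kappa * \sum_(xi in [set: F]) (energy_dilate A xi)%:R.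
  rewrite mulr_sumr mulr_natl -[#|F|](cardsT F) -sumr_const.
  by apply: ler_sum => xi _; apply: EA.
move: le2; rewrite -(ler_nat R) natrX => le2.
have [h|h] := lerP (#|F|%:R) (2 * kappa * #|A|%:R); first by left.
right; rewrite leNgt; apply/negP => h2.
set q : R := #|F|%:R in le1 le3 h *; set m : R := #|A|%:R in Apos le1 le2 le3 h h2 *.
set E : R := \sum_(xi in _) _ in le1 le3.
have le4 : q * m ^+ 3 <= kappa * (q * m ^+ 2 + m ^+ 4).
  apply: le_trans le3 _; rewrite ler_pM2l //; apply: le_trans le1 _.
  by rewrite lerD2l.
have q0 : 0 <= q by rewrite ler0n.
have p1 : 0 < (m - 2 * kappa) * q * m ^+ 2.
  rewrite mulr_gt0 ?exprn_gt0 // mulr_gt0 ?subr_gt0 //.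
  by apply: le_lt_trans h; rewrite !mulr_ge0 // ltW.
have p2 : 0 < (q - 2 * kappa * m) * m ^+ 3.
  by rewrite mulr_gt0 ?exprn_gt0 ?subr_gt0.
nra.
Qed.

(** [#|G| * #|A|] is the trivial maximum for the number of pairs, by [card_line_pairs]; a direction
    is rich if it attains the fraction [1 / (4 * kappa)] of it. *)
Definition rich kappa A G : {set F} :=
  [set v | (v != 0) && (#|G|%:R * #|A|%:R <= 4 * kappa * #|line_pairs A G v|%:R)].

(** In the energy summed over [G], equal pairs use at most a quarter of the lower bound because
    [|A| >= 4 kappa], and poor directions another quarter by the choice of [level]. The remaining
    half forces [|A|^2 <= 2 kappa |Q|], and pigeonhole on the second coordinate yields [b]. *)
Lemma rich_differences kappa A G : 0 < kappa -> A != set0 -> 0 \in G ->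
  {in G, forall xi, #|A|%:R ^+ 3 <= kappa * (energy_dilate A xi)%:R} ->
  4 * kappa <= #|A|%:R ->
  exists2 b, b \in A & #|A|%:R <= 2 * kappa * #|[set a in A | a - b \in rich kappa A G]|%:R.
Proof.
move=> k0 An0 G0 EA Abig.
have Apos : 0 < #|A|%:R :> R by rewrite ltr0n card_gt0.
have Gpos : 0 < #|G|%:R :> R by rewrite ltr0n card_gt0; apply/set0Pn; exists 0.
pose P := [set u in setX A A | u.1 != u.2].
have := energy_sum_le A G; rewrite -(ler_nat R) natrD natr_sum natrM natrX => le1.
pose level : R := #|G|%:R * #|A|%:R / (4 * kappa).
have k4 : 0 < 4 * kappa by rewrite mulr_gt0.
pose f (u : F * F) : R := #|line_pairs A G (u.1 - u.2)|%:R.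
have le2 : {in P, forall u, f u <= #|G|%:R * #|A|%:R}.
  by move=> u _; rewrite /f -natrM ler_nat card_line_pairs.
have l0 : 0 <= level by rewrite divr_ge0 ?mulr_ge0 // ltW.
have {le2} le2 := sum_le_large l0 le2.
set Q := [set i in P | level <= f i] in le2.
have le3 : #|G|%:R * #|A|%:R ^+ 3 <= kappa * \sum_(xi in G) (energy_dilate A xi)%:R.
  rewrite mulr_sumr mulr_natl -sumr_const.
  by apply: ler_sum => xi xiG; apply: EA.
have le4 : #|P|%:R <= #|A|%:R ^+ 2 :> R.
  rewrite -natrX ler_nat -mulnn -cardsX subset_leq_card //.
  by apply/subsetP=> u; rewrite inE => /andP[].
have sumE : (\sum_(u in setX A A | u.1 != u.2) #|line_pairs A G (u.1 - u.2)%R|)%:R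
    = \sum_(u in P) f u.
  by rewrite natr_sum; apply: eq_bigl => u; rewrite !inE.
rewrite sumE in le1.
have Qbig : #|A|%:R ^+ 2 <= 2 * kappa * #|Q|%:R.
  have lv : level * (4 * kappa) = #|G|%:R * #|A|%:R by rewrite divfK // gt_eqF.
  rewrite -(ler_pM2l (mulr_gt0 Gpos Apos)).
  move: le1 le2 le3 le4 Abig lv Apos Gpos.
  move: (\sum_(xi in G) _) (\sum_(u in P) f u) => E S.
  set g : R := #|G|%:R; set m : R := #|A|%:R; set x : R := #|Q|%:R; set y : R := #|P|%:R.
  move=> le1 le2 le3 le4 Abig lv m0 g0.
  have t1 : g * m ^+ 3 <= kappa * (g * m ^+ 2 + (g * m * x + level * y)).
    apply: le_trans le3 _; rewrite ler_pM2l // (le_trans le1) // lerD2l //.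
  have t2 : 4 * kappa * (level * y) <= g * m * m ^+ 2.
    by rewrite mulrA [4 * kappa * _]mulrC lv ler_wpM2l // mulr_ge0 // ltW.
  have t3 : 4 * kappa * (g * m ^+ 2) <= m * (g * m ^+ 2).
    by rewrite ler_wpM2r // mulr_ge0 ?exprn_ge0 // ltW.
  nra.
have QE : Q = [set u in setX A A | u.1 - u.2 \in rich kappa A G].
  apply/setP => u; rewrite !inE subr_eq0 -andbA; congr (_ && (_ && _)).
  by rewrite /level /f ler_pdivrMr // [_ * (4 * kappa)]mulrC.
pose d b := #|[set a in A | a - b \in rich kappa A G]|.
have Qsum : #|Q| = (\sum_(b in A) d b)%N.
  pose g (u : F * F) := (u.2, u.1).
  have gb : bijective g by exists g => -[].
  rewrite QE -(on_card_preimset (onW_bij _ gb)).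
  rewrite (eq_card (B := [set u : F * F |
      (u.1 \in A) && ((u.2 \in A) && (u.2 - u.1 \in rich kappa A G))])).
    rewrite (card_set_pair (fun b a => (b \in A) && ((a \in A) && (a - b \in rich kappa A G)))).
    rewrite [RHS]big_mkcond; apply: eq_bigr => b _; case: ifP => bA.
      by apply: eq_card => a; rewrite !inE.
    by apply: eq_card0 => a; rewrite !inE.
  by move=> [b a]; rewrite !inE /= -!andbA andbCA.
have [b0 b0A] := set0Pn _ An0.
case: (arg_maxnP d b0A) => b bA bmax; exists b => //.
rewrite -/(d b) -(ler_pM2r Apos) -expr2 (le_trans Qbig) // -[leRHS]mulrA.
rewrite ler_pM2l ?mulr_gt0 // -natrM ler_nat Qsum mulnC -sum_nat_const.
exact: leq_sum.
Qed.

End EnergySum.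

(** * Balog-Szemeredi-Gowers *)

Lemma card_incidences (I J : finType) (A : {set I}) (Z : {set J}) (e : I -> J -> bool) :
  (\sum_(a in A) #|[set z in Z | e a z]| = \sum_(z in Z) #|[set a in A | e a z]|)%N.
Proof.
under eq_bigr do rewrite -sum1_card.
rewrite (exchange_big_dep [in Z]) /=; last by move=> a z _; rewrite inE => /andP[].
by apply: eq_bigr => z zZ; rewrite -sum1_card; apply: eq_bigl => a; rewrite !inE zZ.
Qed.

Lemma exists_le_of_sum (R : realFieldType) (I : finType) (P : {set I}) (f g : I -> R) :
  P != set0 -> \sum_(i in P) f i <= \sum_(i in P) g i ->
  exists2 i, i \in P & f i <= g i.
Proof.
move=> /set0Pn[i0 i0P] le; apply/exists_inP; apply: contraLR le.
move=> /exists_inPn gtP; rewrite -ltNge; apply: ltr_sum.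
  by apply/hasP; exists i0; rewrite ?mem_index_enum.
by move=> i /gtP; rewrite -ltNge.
Qed.

Section ThreePaths.
Variables (R : realFieldType) (I J : finType) (e : I -> J -> bool).
Variables (A : {set I}) (Z : {set J}) (delta : R).

(** The inner vertices [p = (a1, z1)] of the paths [a, z1, a1, z] in the bipartite graph [e]. *)
Definition three_paths (a : I) (z : J) : {set I * J} :=
  [set p in setX A Z | [&& e a p.2, e p.1 p.2 & e p.1 z]].

(** Gowers' argument: inside the neighbourhood [A1] of a well chosen [z0], few pairs have few common
    neighbours. A path is then built by choosing [a1] in [A1] adjacent to [z] and not bad with [a],
    and [z1] among the common neighbours of [a] and [a1]. *)
Lemma many_three_paths :
  0 < delta -> A != set0 -> Z != set0 ->
  delta * #|A|%:R * #|Z|%:R <= \sum_(z in Z) #|[set a in A | e a z]|%:R ->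
  exists (A' : {set I}) (Z' : {set J}),
    [/\ A' \subset A, Z' \subset Z, delta * #|A|%:R <= 6 * #|A'|%:R,
        delta * #|Z|%:R <= 4 * #|Z'|%:R &
        {in A' & Z', forall a z, delta ^+ 5 * #|A|%:R * #|Z|%:R
                                   <= 6144 * #|three_paths a z|%:R}].
Proof.
move=> d0 An0 Zn0 dense.
have npos : 0 < #|A|%:R :> R by rewrite ltr0n card_gt0.
have Npos : 0 < #|Z|%:R :> R by rewrite ltr0n card_gt0.
set n : R := #|A|%:R in dense npos *; set N : R := #|Z|%:R in dense Npos *.
pose deg a := #|[set z in Z | e a z]|.
have degN a : (deg a)%:R <= N.
  by rewrite ler_nat; apply/subset_leq_card/subsetP => z; rewrite inE => /andP[].
(* Dropping low degrees keeps half of the edges, and gives every vertex of [A1] the degree needed to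
   make [Z'] large. *)
pose A0 := [set a in A | delta * N / 2 <= (deg a)%:R].
have sA0 : A0 \subset A by apply/subsetP=> a; rewrite inE => /andP[].
pose nb z := [set a in A0 | e a z].
have sum_deg (B : {set I}) :
    \sum_(z in Z) #|[set a in B | e a z]|%:R = \sum_(a in B) (deg a)%:R :> R.
  by rewrite -!natr_sum card_incidences.
have sum_nb : delta * n * N / 2 <= \sum_(z in Z) #|nb z|%:R.
  rewrite sum_deg; move: dense; rewrite sum_deg (big_setID A0) /= (setIidPr sA0).
  have : \sum_(a in A :\: A0) (deg a)%:R <= delta * n * N / 2.
    apply: le_trans (_ : \sum_(a in A :\: A0) (delta * N / 2) <= _).
      apply: ler_sum => a; rewrite !inE => /andP[+ aA].
      by rewrite aA /= -ltNge => /ltW.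
    rewrite sumr_const -[_ *+ #|_|]mulr_natl.
    have -> : delta * n * N / 2 = n * (delta * N / 2) by ring.
    rewrite ler_wpM2r ?ler_nat ?subset_leq_card ?subsetDl //.
    by rewrite divr_ge0 // mulr_ge0 // ltW.
  lra.
have sum_sqr_nb : delta ^+ 2 * n ^+ 2 * N / 4 <= \sum_(z in Z) #|nb z|%:R ^+ 2.
  have := sqr_sum_le Z (fun z => #|nb z|%:R : R); rewrite -/N => cs.
  rewrite -(ler_pM2l Npos); apply: le_trans cs.
  have -> : N * (delta ^+ 2 * n ^+ 2 * N / 4) = (delta * n * N / 2) ^+ 2 by field.
  by rewrite ler_sqr ?nnegrE ?sumr_ge0 // divr_ge0 // !mulr_ge0 // ltW.
pose codeg a a' := #|[set z in Z | e a z && e a' z]|.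
pose bad a a' := (codeg a a')%:R < delta ^+ 3 * N / 256.
pose badp z := #|[set u in setX (nb z) (nb z) | bad u.1 u.2]|.
have sum_badp : \sum_(z in Z) (badp z)%:R <= delta ^+ 3 * n ^+ 2 * N / 256.
  pose B := [set u in setX A0 A0 | bad u.1 u.2].
  have -> : \sum_(z in Z) (badp z)%:R = \sum_(u in B) (codeg u.1 u.2)%:R :> R.
    rewrite -!natr_sum; congr (_%:R).
    rewrite [RHS](card_incidences B Z (fun u z => e u.1 z && e u.2 z)).
    apply: eq_bigr => z _; apply: eq_card => -[a a']; rewrite !inE /=.
    by case: (e a z); case: (e a' z); rewrite ?andbF ?andbT.
  apply: le_trans (_ : \sum_(u in B) (delta ^+ 3 * N / 256) <= _).
    by apply: ler_sum => u; rewrite !inE => /andP[_ /ltW].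
  rewrite sumr_const -[_ *+ #|_|]mulr_natl.
  have -> : delta ^+ 3 * n ^+ 2 * N / 256 = n ^+ 2 * (delta ^+ 3 * N / 256) by ring.
  apply: ler_wpM2r; first by rewrite divr_ge0 // mulr_ge0 ?exprn_ge0 // ltW.
  rewrite -natrX ler_nat -mulnn -cardsX; apply/subset_leq_card/subsetP => u.
  by rewrite !inE => /andP[/andP[/andP[-> _] /andP[-> _]] _].
(* One average yields two properties: the weight 32 on bad pairs uses half of the lower bound for
   the squared degrees, and the other half, [delta ^+ 3 * n ^+ 2 / 8], forces the neighbourhood of
   [z0] to be large. *)
have [z0 z0Z z0P] : exists2 z, z \in Z &
    32 * (badp z)%:R + delta ^+ 3 * n ^+ 2 / 8 <= delta * #|nb z|%:R ^+ 2.
  apply: exists_le_of_sum => //; rewrite big_split /= sumr_const -!mulr_sumr.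
  rewrite -[_ *+ #|Z|]mulr_natl -/N.
  have := ler_wpM2l (ltW d0) sum_sqr_nb.
  have -> : delta * (delta ^+ 2 * n ^+ 2 * N / 4) = delta ^+ 3 * n ^+ 2 * N / 4 by ring.
  move: sum_badp.
  have -> : N * (delta ^+ 3 * n ^+ 2 / 8) = delta ^+ 3 * n ^+ 2 * N / 8 by ring.
  set w := delta ^+ 3 * n ^+ 2 * N; lra.
pose A1 := nb z0; set m : R := #|A1|%:R.
have sA1 : A1 \subset A0 by apply/subsetP=> a; rewrite inE => /andP[].
have {}z0P : 32 * (badp z0)%:R + delta ^+ 3 * n ^+ 2 / 8 <= delta * m ^+ 2 by [].
have m0 : 0 <= m by rewrite ler0n.
have mbig : delta * n <= 3 * m.
  rewrite -ler_sqr ?nnegrE ?mulr_ge0 // ?(ltW d0) ?(ltW npos) //.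
  have b0 : 0 <= (badp z0)%:R :> R by [].
  have h : delta ^+ 3 * n ^+ 2 / 8 <= delta * m ^+ 2 by lra.
  rewrite -(ler_pM2l d0) !exprMn.
  have -> : delta * (delta ^+ 2 * n ^+ 2) = 8 * (delta ^+ 3 * n ^+ 2 / 8) by field.
  have m20 : 0 <= delta * m ^+ 2 by rewrite mulr_ge0 ?exprn_ge0 // ltW.
  have -> : delta * (3 ^+ 2 * m ^+ 2) = 9 * (delta * m ^+ 2) by ring.
  lra.
have mpos : 0 < m.
  have : 0 < delta * n by rewrite mulr_gt0.
  by move: mbig; lra.
have badsmall : 32 * (badp z0)%:R <= delta * m ^+ 2.
  have : 0 <= delta ^+ 3 * n ^+ 2 / 8 by rewrite divr_ge0 // mulr_ge0 ?exprn_ge0 // ltW.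
  by move: z0P; lra.
pose badd a := #|[set a' in A1 | bad a a']|.
have baddE : (badp z0)%:R = \sum_(a in A1) (badd a)%:R :> R.
  rewrite -natr_sum; congr (_%:R).
  rewrite /badp -/A1.
  rewrite (eq_card (B := [set u : I * I | (u.1 \in A1) && ((u.2 \in A1) && bad u.1 u.2)])).
    rewrite (card_set_pair (fun a a' => (a \in A1) && ((a' \in A1) && bad a a'))).
    rewrite [RHS]big_mkcond; apply: eq_bigr => a _; case: ifP => aA.
      by apply: eq_card => a'; rewrite [in LHS]in_set [in RHS]in_set.
    by apply: eq_card0 => a'; rewrite in_set.
  by move=> [a a']; rewrite in_set [in RHS]in_set in_setX /= andbA.
(* Since [32 * badp z0 <= delta * m ^+ 2], at most half of [A1] has [delta * m / 16] or more bad
   partners. *)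
pose A2 := [set a in A1 | ~~ (delta * m / 16 <= (badd a)%:R)].
have sA2 : A2 \subset A1 by apply/subsetP=> a; rewrite inE => /andP[].
pose Z' := [set z in Z | delta * m / 4 <= #|[set a in A1 | e a z]|%:R].
exists A2, Z'; split.
- exact: subset_trans sA2 (subset_trans sA1 sA0).
- by apply/subsetP=> z; rewrite inE => /andP[].
- have : (#|A1 :\: A2|%:R : R) * (delta * m / 16) <= \sum_(a in A1) (badd a)%:R.
    rewrite [_%:R * _]mulr_natl -sumr_const [leRHS](big_setID A2) /= (setIidPr sA2).
    rewrite ler_wpDl ?sumr_ge0 //; apply: ler_sum => a; rewrite !inE negb_and negbK.
    by move=> /andP[/orP[/negP//|->]].
  rewrite -baddE cardsD (setIidPr sA2) natrB ?subset_leq_card // -/m.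
  have p32 : 0 <= 32 :> R by [].
  move=> h; have {h} := le_trans (ler_wpM2l p32 h) badsmall.
  have -> : 32 * ((m - #|A2|%:R) * (delta * m / 16)) = (delta * m) * (2 * (m - #|A2|%:R)) by field.
  rewrite expr2 [leRHS]mulrA ler_pM2l ?mulr_gt0 // => h; move: mbig; lra.
- have nbA1 : {in Z, forall z, #|[set a in A1 | e a z]|%:R <= m}.
    by move=> z _; rewrite ler_nat; apply/subset_leq_card/subsetP => a; rewrite inE => /andP[].
  have l0 : 0 <= delta * m / 4 by rewrite divr_ge0 // mulr_ge0 // ltW.
  have := sum_le_large l0 nbA1; rewrite -/Z' -/N sum_deg => ub.
  have lb : m * (delta * N / 2) <= \sum_(a in A1) (deg a)%:R.
    rewrite [_%:R * _]mulr_natl -sumr_const; apply: ler_sum => a /(subsetP sA1).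
    by rewrite inE => /andP[].
  have := le_trans lb ub.
  have -> : m * (delta * N / 2) = m * (delta * N / 4) + delta * m / 4 * N by field.
  by rewrite lerD2r ler_pM2l // => h; move: h; lra.
move=> a z aA2 zZ'.
(* Of at least [delta * m / 4] neighbours of [z] in [A1], fewer than [delta * m / 16] are bad with
   [a]. The constant is [6144 = 8 * 256 * 3], with 3 from [delta * n <= 3 * m]. *)
pose good := [set a1 in A1 | e a1 z && ~~ bad a a1].
have goodbig : delta * m / 8 <= #|good|%:R.
  have : (#|[set a1 in A1 | e a1 z]| <= badd a + #|good|)%N.
    apply: leq_trans (leq_card_setU _ _); apply/subset_leq_card/subsetP => a1.
    rewrite !inE => /andP[-> ->] /=; exact: orbN.
  move: aA2 zZ'; rewrite !inE -ltNge => /andP[_ h1] /andP[_ h2].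
  rewrite -(ler_nat R) natrD => h3.
  have : 0 <= delta * m by rewrite mulr_ge0 // ltW.
  move: h1 h2 h3; lra.
have pathsE : (\sum_(a1 in good) codeg a a1 <= #|three_paths a z|)%N.
  rewrite /three_paths (eq_card (B := [set p : I * J |
      (p.1 \in A) && ((p.2 \in Z) && [&& e a p.2, e p.1 p.2 & e p.1 z])])); last first.
    by move=> [a1 z1]; rewrite !inE /= -!andbA.
  rewrite (card_set_pair (fun a1 z1 =>
      (a1 \in A) && ((z1 \in Z) && [&& e a z1, e a1 z1 & e a1 z]))).
  rewrite big_mkcond; apply: leq_sum => a1 _; case: ifP => // a1good.
  apply/subset_leq_card/subsetP => z1; rewrite !inE => /andP[-> /andP[-> ->]].
  move: a1good; rewrite inE => /andP[a1A1 /andP[-> _]].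
  by rewrite (subsetP sA0) // (subsetP sA1).
have : delta * m / 8 * (delta ^+ 3 * N / 256) <= #|three_paths a z|%:R.
  apply: le_trans (_ : (\sum_(a1 in good) codeg a a1)%:R <= _); last by rewrite ler_nat.
  apply: le_trans (_ : #|good|%:R * (delta ^+ 3 * N / 256) <= _).
    by rewrite ler_wpM2r // divr_ge0 // mulr_ge0 ?exprn_ge0 // ltW.
  rewrite natr_sum mulr_natl -sumr_const; apply: ler_sum => a1.
  by rewrite inE => /and3P[_ _]; rewrite -leNgt.
move=> h; apply: le_trans (ler_wpM2l _ h) => //.
have -> : 6144 * (delta * m / 8 * (delta ^+ 3 * N / 256)) = (delta ^+ 4 * N) * (3 * m) by field.
have -> : delta ^+ 5 * n * N = (delta ^+ 4 * N) * (delta * n) by ring.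
by rewrite ler_wpM2l // mulr_ge0 ?exprn_ge0 // ltW.
Qed.

End ThreePaths.

Lemma sum_fibres_le (S T : finType) (f : S -> T) (D : {set T}) (W : {set S}) :
  (\sum_(y in D) #|[set w in W | f w == y]| <= #|W|)%N.
Proof.
rewrite (card_incidences D W (fun y w => f w == y)) -[leqRHS]sum1_card.
apply: leq_sum => w _; rewrite -(cards1 (f w)); apply/subset_leq_card/subsetP => y.
by rewrite !inE eq_sym => /andP[].
Qed.

Section Popular.
Variables (F : finFieldType) (R : realFieldType) (K : R).
Implicit Types (A : {set F}) (xi : F).

Definition popular A xi : {set F} :=
  [set t in [set u.1 - xi * u.2 | u in setX A A] |
    #|A|%:R / (2 * K) <= #|[set u in setX A A | u.1 - xi * u.2 == t]|%:R].

(** Unpopular differences contribute at most [|A| / (2 K) * |A|^2], half of the assumed energy. No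
    difference has more than [|A|] representations, so the popular ones are represented by a
    proportion [1 / (2 K)] of all pairs. *)
Lemma popular_differences A xi : 0 < K -> A != set0 ->
  #|A|%:R ^+ 3 / K <= (energy_dilate A xi)%:R ->
  #|popular A xi|%:R <= 2 * K * #|A|%:R /\
  #|A|%:R ^+ 2 <= 2 * K * #|[set u in setX A A | u.1 - xi * u.2 \in popular A xi]|%:R.
Proof.
move=> K0 An0 EA.
have npos : 0 < #|A|%:R :> R by rewrite ltr0n card_gt0.
set n : R := #|A|%:R in EA npos *.
pose f (u : F * F) := u.1 - xi * u.2.
pose r t := #|[set u in setX A A | f u == t]|.
have rn t : (r t <= #|A|)%N.
  have inj : {in [set u in setX A A | f u == t] &, injective snd}.
    move=> [a b] [c d]; rewrite !inE /f /= => /andP[_ /eqP e] /andP[_ /eqP e'] e2.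
    by move: e; rewrite -e' e2 => /addIr ->.
  rewrite /r -(card_in_imset inj); apply/subset_leq_card/subsetP => y /imsetP[[a b] abP ->].
  by move: abP; rewrite !inE /= => /andP[/andP[]].
set T := popular A xi.
have K2 : 0 < 2 * K by rewrite mulr_gt0.
have sumr : (\sum_(t in f @: setX A A) r t = #|A| ^ 2)%N.
  by rewrite card_fibres cardsX mulnn.
have sumT : (\sum_(t in T) r t = #|[set u in setX A A | f u \in T]|)%N.
  rewrite (card_incidences T (setX A A) (fun t u => f u == t)) -sum1_card.
  rewrite [RHS](eq_bigl (fun u => (u \in setX A A) && (f u \in T))); last by move=> u; rewrite inE.
  rewrite big_mkcondr; apply: eq_bigr => u _; case: ifP => uT.
    rewrite -(cards1 (f u)); apply: eq_card => t; rewrite in_set in_set1 [t == _]eq_sym.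
    by case: eqP => [<-|_]; rewrite ?uT ?andbT ?andbF.
  apply: eq_card0 => t; rewrite in_set; case: eqP => [<-|_]; rewrite ?andbF //.
  by rewrite uT.
have sTf : T \subset f @: setX A A by apply/subsetP=> t; rewrite inE => /andP[].
split.
  have : n / (2 * K) * #|T|%:R <= n ^+ 2.
    rewrite -natrX -sumr natr_sum mulr_natr -sumr_const.
    apply: le_trans (_ : \sum_(t in T) (r t)%:R <= _).
      by apply: ler_sum => t; rewrite inE => /andP[].
    by rewrite [leRHS](big_setID T) /= (setIidPr sTf) lerDl sumr_ge0.
  rewrite mulrAC ler_pdivrMr // => h.
  by rewrite -(ler_pM2l npos); lra.
rewrite -sumT natr_sum.
have : (energy_dilate A xi)%:R <= n * (\sum_(t in T) (r t)%:R) + n / (2 * K) * n ^+ 2.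
  rewrite card_energy_sub (card_collisions f) -natrX -sumr !natr_sum (big_setID T) /=.
  rewrite (setIidPr sTf); apply: lerD.
    rewrite mulr_sumr; apply: ler_sum => t _.
    by rewrite natrX expr2 ler_wpM2r // ler_nat rn.
  apply: le_trans (_ : \sum_(t in f @: setX A A :\: T) n / (2 * K) * (r t)%:R <= _).
    apply: ler_sum => t; rewrite inE [t \in T]inE => /andP[+ tf].
    rewrite tf /= -ltNge => /ltW h.
    by rewrite natrX expr2 ler_wpM2r.
  rewrite mulr_sumr [leRHS](big_setID T) /= lerDr sumr_ge0 // => t _.
  by rewrite mulr_ge0 // divr_ge0 // ltW.
move/(le_trans EA).
set S := \sum_(t in T) _ => h.
have e1 : n ^+ 3 / K = n * (2 * (n ^+ 2 / (2 * K))) by field; rewrite gt_eqF.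
have e2 : n / (2 * K) * n ^+ 2 = n * (n ^+ 2 / (2 * K)) by ring.
move: h; rewrite e1 e2 -mulrDr ler_pM2l // => h.
have : n ^+ 2 / (2 * K) <= S by lra.
by rewrite ler_pdivrMr // mulrC.
Qed.

End Popular.

(** As [6144 = 3 * 2 ^ 11], the left side is [54 * 2 ^ 29 * x]. The remaining [2 ^ 19] of [2 ^ 54]
    comes from [delta = 1 / (2 K)] to the power 19. *)
Lemma dilate_constant (R : realFieldType) (x : R) :
  0 <= x -> 6144 ^+ 2 * 128 * (6 * x) <= 2 ^+ 35 * x.
Proof. by lra. Qed.

Section CommonDilates.
Variables (F : finFieldType) (R : realFieldType) (K : R) (A X : {set F}).
Hypotheses (K0 : 0 < K) (An0 : A != set0) (Xn0 : X != set0) (X0 : 0 \notin X).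
Hypothesis energyX :
  forall xi, xi \in X -> #|A|%:R ^+ 3 / K <= (energy_dilate A xi)%:R.

Let n : R := #|A|%:R.
Let N : R := #|X|%:R.
Let delta : R := (2 * K)^-1.
Let T := popular K A.
Let e (a : F) (z : F * F) := a - z.2 * z.1 \in T z.2.

Let npos : 0 < n. Proof. by rewrite ltr0n card_gt0. Qed.
Let Npos : 0 < N. Proof. by rewrite ltr0n card_gt0. Qed.
Let d0 : 0 < delta. Proof. by rewrite invr_gt0 mulr_gt0. Qed.

(* A single bipartite graph, between A and all pairs (b, xi), serves all the
   dilates at once, so that the popular set A' does not depend on xi. *)
Lemma common_differences : exists (A' X' : {set F}) (B : F -> {set F}),
  [/\ A' \subset A, X' \subset X, delta * n <= 6 * #|A'|%:R, delta * N <= 8 * #|X'|%:R &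
    forall xi, xi \in X' -> [/\ B xi \subset A, delta * n <= 8 * #|B xi|%:R &
      #|sumset A' (oppset (dilate xi (B xi)))|%:R * delta ^+ 8 <= 6144 * n]].
Proof.
pose Z := setX A X.
have Zn0 : Z != set0.
  have [a aA] := set0Pn _ An0; have [x xX] := set0Pn _ Xn0.
  by apply/set0Pn; exists (a, x); rewrite inE aA xX.
have ZE : #|Z|%:R = n * N :> R by rewrite cardsX natrM.
have dense : delta * n * #|Z|%:R <= \sum_(z in Z) #|[set a in A | e a z]|%:R.
  rewrite ZE (eq_bigl (fun z : F * F => (z.1 \in A) && (z.2 \in X))); last first.
    by move=> [b x]; rewrite inE.
  rewrite -(pair_big_dep [in A] (fun _ => [in X]) (fun b x => #|[set a in A | e a (b, x)]|%:R)) /=.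
  rewrite exchange_big /=.
  have -> : delta * n * (n * N) = N * (n ^+ 2 / (2 * K)) by rewrite /delta; ring.
  rewrite /N [_ * (n ^+ 2 / _)]mulr_natl -sumr_const; apply: ler_sum => xi xiX.
  have [_] := popular_differences K0 An0 (energyX xiX).
  rewrite -ler_pdivrMl ?mulr_gt0 // mulrC => /le_trans; apply.
  rewrite -natr_sum ler_nat.
  rewrite (eq_card (B := [set u : F * F | (u.1 \in A) && ((u.2 \in A) && e u.1 (u.2, xi))])).
    rewrite (card_set_pair (fun a b => (a \in A) && ((b \in A) && e a (b, xi)))).
    rewrite -(card_incidences A A (fun a b => e a (b, xi))) [leqRHS]big_mkcond /=.
    apply: leq_sum => a _; case: ifP => aA; first by [].
    by rewrite leqn0; apply/eqP/eq_card0 => b; rewrite inE.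
  by move=> [a b]; rewrite [LHS]in_set [RHS]in_set in_setX /= andbA.
have [A' [Z' [sA' sZ' A'big Z'big paths]]] := many_three_paths d0 An0 Zn0 dense.
pose B xi := [set b in A | (b, xi) \in Z'].
have BA xi : B xi \subset A by apply/subsetP=> b; rewrite inE => /andP[].
pose X' := [set xi in X | delta * n / 8 <= #|B xi|%:R].
exists A', X', B; split => //.
- by apply/subsetP=> x; rewrite inE => /andP[].
- have Bn : {in X, forall xi, #|B xi|%:R <= n} by move=> xi _; rewrite ler_nat subset_leq_card.
  have l0 : 0 <= delta * n / 8 by rewrite divr_ge0 // mulr_ge0 // ltW.
  have := sum_le_large l0 Bn; rewrite -/X' -natr_sum.
  have -> : (\sum_(xi in X) #|B xi| = #|Z'|)%N.
    rewrite (card_incidences X A (fun xi b => (b, xi) \in Z')).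
    rewrite [RHS](eq_card (B := [set u : F * F |
        (u.1 \in A) && ((u.2 \in X) && ((u.1, u.2) \in Z'))])).
      rewrite (card_set_pair (fun b x => (b \in A) && ((x \in X) && ((b, x) \in Z')))).
      rewrite big_mkcond; apply: eq_bigr => b _; case: ifP => bA.
        by apply: eq_card => x; rewrite [LHS]in_set [RHS]in_set.
      by apply/esym/eq_card0 => x; rewrite in_set.
    move=> [b x]; rewrite [RHS]in_set /=; apply/idP/idP => [bxZ|/and3P[]//].
    by rewrite bxZ andbT -in_setX (subsetP sZ').
  move=> ub; move: Z'big; rewrite ZE -/N.
  move: ub; rewrite -/N; set z := #|Z'|%:R; set x := #|X'|%:R => h1 h2.
  have : n * (delta * N) <= n * (8 * x) by move: h1 h2; lra.
  by rewrite ler_pM2l.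
move=> xi; rewrite inE => /andP[xiX Bbig]; split => //.
  by move: Bbig; lra.
set D := sumset _ _.
(* A path [a, (b1, x1), a1, (b, xi)] writes [a - xi b] as
   [(a - x1 b1) - (a1 - x1 b1) + (a1 - xi b)], with two terms in [T x1] and one in [T xi]. Recording
   [x1], which is nonzero, makes the path recoverable from the terms. So each element of [D] has
   many representations by [W], and [W] is small. *)
pose S0 : {set F * (F * F)} := [set s | (s.1 \in X) && (s.2 \in setX (T s.1) (T s.1))].
pose W := setX S0 (T xi).
pose f (w : F * (F * F) * F) := w.1.2.1 - w.1.2.2 + w.2.
have Tle x : x \in X -> #|T x|%:R <= n / delta.
  move=> xX; have [] := popular_differences K0 An0 (energyX xX).
  by rewrite /delta invrK mulrC.
have Wle : #|W|%:R <= N * (n / delta) ^+ 3.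
  rewrite cardsX natrM exprSr mulrA ler_pM ?Tle //.
  rewrite /S0 (card_set_pair (fun x t => (x \in X) && (t \in setX (T x) (T x)))).
  rewrite natr_sum /N [#|X|%:R * _]mulr_natl -sumr_const [leRHS]big_mkcond /=.
  apply: ler_sum => x _.
  case: ifP => xX; last first.
    by rewrite (_ : #|_| = 0)%N //; apply: eq_card0 => t; rewrite inE.
  rewrite (_ : #|_| = #|T x| * #|T x|)%N; last first.
    by rewrite -cardsX; apply: eq_card => t; rewrite [in LHS]inE.
  by rewrite natrM expr2 ler_pM ?Tle.
have fib x : x \in D -> delta ^+ 5 * n * (n * N) <= 6144 * #|[set w in W | f w == x]|%:R.
  move=> /imset2P[a y aA' yB ->]; move: yB; rewrite mem_oppset => /imsetP[b bB xE].
  move: bB; rewrite inE => /andP[bA bZ'].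
  rewrite -ZE; apply: le_trans (paths a (b, xi) aA' bZ') _.
  rewrite ler_pM2l // ler_nat.
  pose h (p : F * (F * F)) := ((p.2.2, (a - p.2.2 * p.2.1, p.1 - p.2.2 * p.2.1)), p.1 - xi * b).
  rewrite -(@card_in_imset _ _ h).
    apply/subset_leq_card/subsetP => w /imsetP[[a1 [b1 x1]] pP ->].
    move: pP; rewrite in_set !in_setX /= => /andP[/and3P[a1A b1A x1X] /and3P[e1 e2 e3]].
    have e1' : a - x1 * b1 \in T x1 := e1.
    have e2' : a1 - x1 * b1 \in T x1 := e2.
    have e3' : a1 - xi * b \in T xi := e3.
    rewrite in_set in_setX in_set /= in_setX /= x1X e1' e2' e3' /=.
    by apply/eqP; rewrite /f /= -[y]opprK xE; ring.
  move=> [a1 [b1 x1]] [a2 [b2 x2]]; rewrite in_set !in_setX /=.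
  move=> /andP[/and3P[_ _ x1X] _] _ [<- e1 e2 _].
  have x10 : x1 != 0 by apply: contraNneq X0 => <-.
  move: e1 => /addrI/oppr_inj/(mulfI x10) e1; move: e2; rewrite e1 => /addIr ->.
  by [].
have : #|D|%:R * (delta ^+ 5 * n * (n * N)) <= 6144 * (N * (n / delta) ^+ 3).
  apply: le_trans (_ : 6144 * #|W|%:R <= _); last by rewrite ler_pM2l.
  apply: le_trans (_ : 6144 * (\sum_(x in D) #|[set w in W | f w == x]|)%:R <= _).
    rewrite natr_sum mulr_sumr mulr_natl -sumr_const; exact: ler_sum.
  by rewrite ler_pM2l // ler_nat sum_fibres_le.
have -> : #|D|%:R * (delta ^+ 5 * n * (n * N)) =
    (N * n ^+ 2 * delta ^- 3) * (#|D|%:R * delta ^+ 8) by field; rewrite gt_eqF.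
have -> : 6144 * (N * (n / delta) ^+ 3) = (N * n ^+ 2 * delta ^- 3) * (6144 * n).
  by field; rewrite gt_eqF.
by rewrite ler_pM2l // divr_gt0 ?exprn_gt0 // mulr_gt0 // exprn_gt0.
Qed.

(** [A'] is common to all dilates, but [B xi] still varies. By Cauchy-Schwarz some [B x0] has a
    large intersection [B2] with [B y] for many [y]. As [y B2] lies in [y B y] and equals
    [(y / x0) (x0 B2)], the triangle inequality through it bounds [A' - (y / x0) A']; hence
    ratios. *)
Lemma common_dilates : exists (A' Y : {set F}),
  [/\ A' \subset A, 1 \in Y, #|A|%:R <= 12 * K * #|A'|%:R, #|X|%:R <= 2 ^+ 13 * K ^+ 3 * #|Y|%:R &
    {in Y, forall y, dilate_bounded (2 ^+ 54 * K ^+ 19) A' y}].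
Proof.
have [A' [X1 [B [sA' sX1 A'big X1big BP]]]] := common_differences.
have X1n0 : X1 != set0.
  apply/eqP => X1E; have : 0 < delta * N by rewrite mulr_gt0.
  by move: X1big; rewrite X1E cards0 mulr0; lra.
pose x1 : R := #|X1|%:R.
have x1pos : 0 < x1 by rewrite ltr0n card_gt0.
pose t b := #|[set x in X1 | b \in B x]|.
have sumt : x1 * (delta * n / 8) <= \sum_(b in A) (t b)%:R.
  rewrite -natr_sum (card_incidences A X1 (fun b x => b \in B x)) natr_sum.
  rewrite /x1 [#|X1|%:R * _]mulr_natl -sumr_const; apply: ler_sum => x /BP[sBA + _].
  rewrite (_ : [set b in A | b \in B x] = B x); first by lra.
  by apply/setP=> b; rewrite inE andb_idl // => /(subsetP sBA).
pose c x y := #|[set b in A | (b \in B x) && (b \in B y)]|.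
have sumc : (x1 * (delta * n / 8)) ^+ 2 <= n * (\sum_(x in X1) \sum_(y in X1) (c x y)%:R).
  apply: le_trans (_ : (\sum_(b in A) (t b)%:R) ^+ 2 <= _).
    rewrite ler_sqr ?nnegrE ?sumr_ge0 //.
    by rewrite mulr_ge0 ?divr_ge0 ?mulr_ge0 // ltW.
  apply: le_trans (sqr_sum_le _ _) _; rewrite ler_pM2l //.
  rewrite pair_big_dep /= [leRHS](eq_bigl [in setX X1 X1]); last by move=> [x y]; rewrite inE.
  rewrite -natr_sum -(card_incidences A (setX X1 X1) (fun b u => (b \in B u.1) && (b \in B u.2))).
  rewrite natr_sum; apply: ler_sum => b _.
  rewrite -natrX ler_nat /t -mulnn -cardsX; apply/subset_leq_card/subsetP => -[x y].
  by rewrite !inE /= => /andP[/andP[-> ->] /andP[-> ->]].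
have [x0 x0X1 x0P] : exists2 x, x \in X1 &
    x1 * delta ^+ 2 * n / 64 <= \sum_(y in X1) (c x y)%:R.
  apply: exists_le_of_sum => //; rewrite sumr_const -[_ *+ #|X1|]mulr_natl -/x1.
  rewrite -(ler_pM2l npos); apply: le_trans sumc.
  by rewrite le_eqVlt; apply/orP; left; apply/eqP; field.
have [sB0 B0big _] := BP _ x0X1.
have x00 : x0 != 0 by apply: contraNneq X0 => <-; rewrite (subsetP sX1).
have K2 : K = (2 * delta)^-1 by rewrite /delta; field; rewrite gt_eqF.
(* This puts [x0] itself above the overlap level, so that [1 = x0 / x0] lies in [Y]. *)
have d8 : delta <= 8.
  have h : #|B x0|%:R <= n by rewrite ler_nat subset_leq_card.
  by rewrite -(ler_pM2r npos); lra.
pose level := delta ^+ 2 * n / 128.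
pose X2 := [set y in X1 | level <= (c x0 y)%:R].
pose Y := [set y / x0 | y in X2].
have Ycard : #|Y| = #|X2| by apply: card_imset; apply: mulIf; rewrite invr_eq0.
exists A', Y; split => //.
- apply/imsetP; exists x0; last by rewrite divff.
  rewrite inE x0X1 /=; apply: le_trans (_ : #|B x0|%:R <= _); last first.
    rewrite ler_nat; apply/subset_leq_card/subsetP => b bB.
    by rewrite inE (subsetP sB0) // bB.
  have : delta * (delta * n) <= 8 * (delta * n) by rewrite ler_wpM2r // mulr_ge0 // ltW.
  have : 0 <= #|B x0|%:R :> R by [].
  by rewrite /level; move: B0big; lra.
- rewrite K2 -(ler_pM2l d0); apply: le_trans A'big _.
  by rewrite le_eqVlt; apply/orP; left; apply/eqP; field; rewrite gt_eqF.
- have cn : {in X1, forall y, (c x0 y)%:R <= n}.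
    move=> y _; rewrite ler_nat; apply/subset_leq_card/subsetP => b.
    by rewrite inE => /andP[].
  have l0 : 0 <= level by rewrite divr_ge0 // mulr_ge0 ?exprn_ge0 // ltW.
  have ub := le_trans x0P (sum_le_large l0 cn).
  rewrite -/X2 -/x1 -Ycard /level in ub; rewrite K2.
  set y : R := #|Y|%:R in ub *.
  have d3 : 0 < delta ^+ 3 by rewrite exprn_gt0.
  have h1 : delta ^+ 2 * x1 <= 128 * y.
    rewrite -(ler_pM2l npos).
    have -> : n * (delta ^+ 2 * x1) = 
        128 * (x1 * delta ^+ 2 * n / 64 - delta ^+ 2 * n / 128 * x1) by field.
    by lra.
  have h2 : delta ^+ 2 * (delta * N) <= delta ^+ 2 * (8 * x1).
    by rewrite ler_wpM2l // exprn_ge0 // ltW.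
  rewrite -(ler_pM2l d3).
  have -> : delta ^+ 3 * (2 ^+ 13 * (2 * delta)^-1 ^+ 3 * y) = 1024 * y.
    by field; rewrite gt_eqF.
  by move: h1 h2; rewrite exprS -mulrA; lra.
move=> w /imsetP[y yX2 ->]; move: yX2; rewrite inE => /andP[yX1 cbig].
have [_ _ yP] := BP _ yX1; have [_ _ x0P'] := BP _ x0X1.
have y0 : y != 0 by apply: contraNneq X0 => <-; rewrite (subsetP sX1).
pose B2 := B x0 :&: B y.
have B2E : #|B2| = c x0 y.
  by apply: eq_card => b; rewrite [RHS]inE andb_idl ?inE // => /andP[/(subsetP sB0)].
pose D x := sumset A' (oppset (dilate x B2)).
have Dle x : x \in X1 -> B2 \subset B x -> #|D x|%:R * delta ^+ 8 <= 6144 * n.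
  move=> /BP[_ _ h] sB; apply: le_trans h; rewrite ler_wpM2r ?exprn_ge0 ?(ltW d0) // ler_nat.
  apply/subset_leq_card/sumsetS => //; apply/subsetP=> z.
  rewrite !mem_oppset => /imsetP[b bB ->]; apply: mem_dilate; exact: (subsetP sB).
have := ruzsa_triangle A' (oppset (dilate (y / x0) A')) (dilate y B2).
have -> : dilate y B2 = dilate (y / x0) (dilate x0 B2) by rewrite dilateM divfK.
rewrite -[X in sumset (dilate _ _) X]dilate_oppset -dilate_sumset.
have yx0 : y / x0 != 0 by rewrite mulf_neq0 ?invr_eq0.
rewrite [X in (_ <= _ * X)%N]card_dilate // !card_dilate //.
rewrite dilateM divfK // -[X in (_ <= _ * X)%N]card_oppset oppset_sumset oppsetK.
rewrite [X in (_ <= _ * #|pred_of_set X|)%N]sumsetC -/(D x0) -/(D y) B2E -(ler_nat R) !natrM.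
rewrite /dilate_bounded; set S := #|sumset _ _|%:R => tri.
have Dy := Dle y yX1 (subsetIr _ _); have Dx := Dle x0 x0X1 (subsetIl _ _).
have d8p : 0 <= delta ^+ 8 by rewrite exprn_ge0 // ltW.
have DD := ler_pM (mulr_ge0 (ler0n _ _) d8p) (mulr_ge0 (ler0n _ _) d8p) Dy Dx.
have S0 : 0 <= S by rewrite ler0n.
have h1 : S * level * delta ^+ 16 <= 6144 * n * (6144 * n).
  apply: le_trans DD.
  apply: le_trans (_ : S * (c x0 y)%:R * delta ^+ 16 <= _).
    by rewrite ler_wpM2r ?ler_wpM2l ?exprn_ge0 // ltW.
  rewrite [leRHS](_ : _ = (#|D y|%:R * #|D x0|%:R) * delta ^+ 16); last by ring.
  by rewrite ler_wpM2r ?exprn_ge0 // ltW.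
have h2 : S * delta ^+ 18 <= 6144 ^+ 2 * 128 * n.
  rewrite -(ler_pM2l npos).
  have -> : n * (S * delta ^+ 18) = 128 * (S * level * delta ^+ 16) by rewrite /level; field.
  have -> : n * (6144 ^+ 2 * 128 * n) = 128 * (6144 * n * (6144 * n)) by ring.
  by rewrite ler_pM2l.
have h3 : S * delta ^+ 19 <= 6144 ^+ 2 * 128 * (6 * #|A'|%:R).
  rewrite (exprSr delta 18) [leLHS]mulrA; apply: le_trans (ler_wpM2r (ltW d0) h2) _.
  by rewrite -[leLHS]mulrA [n * _]mulrC ler_wpM2l // mulr_ge0 // exprn_ge0.
have d19 : 0 < delta ^+ 19 by rewrite exprn_gt0.
rewrite K2 -(ler_pM2r d19); apply: le_trans h3 _.
have -> : 2 ^+ 54 * (2 * delta)^-1 ^+ 19 * #|A'|%:R * delta ^+ 19 = 2 ^+ 35 * #|A'|%:R.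
  by field; rewrite gt_eqF.
exact: dilate_constant.
Qed.

End CommonDilates.

(** * Quotient sets and subfields *)

Section Quotients.
Variable F : finFieldType.
Implicit Types (Y N H G W : {set F}).

Definition quotient_set Y : {set F} :=
  [set (u.1.1 - u.1.2) / (u.2.1 - u.2.2) |
    u in [set u in setX (setX Y Y) (setX Y Y) | u.2.1 != u.2.2]].

Lemma quotientP Y x : reflect
  (exists a b c d, [/\ [/\ a \in Y, b \in Y, c \in Y & d \in Y], c != d & x = (a - b) / (c - d)])
  (x \in quotient_set Y).
Proof.
apply: (iffP imsetP) => [[[[a b] [c d]]]|[a [b [c [d [[aY bY cY dY] cd ->]]]]]].
  rewrite inE !in_setX /= => /andP[/andP[/andP[aY bY] /andP[cY dY]] cd] ->.
  by exists a, b, c, d.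
by exists ((a, b), (c, d)); rewrite // inE !in_setX /= aY bY cY dY.
Qed.

Definition subring_set H :=
  [/\ 1 \in H, {in H &, forall x y, x - y \in H} & {in H &, forall x y, x * y \in H}].

(** Multiplication by a nonzero [y] of [H] is injective on the finite set [H], hence onto. *)
Lemma subring_div H x y : subring_set H -> x \in H -> y \in H -> x / y \in H.
Proof.
move=> [H1 HB HM] xH yH; have [->|y0] := eqVneq y 0.
  by rewrite invr0 mulr0 -(subrr x) HB.
have /eqP yHE : dilate y H == H.
  rewrite eqEcard card_dilate // leqnn andbT; apply/subsetP=> z /imsetP[h hH ->].
  exact: HM.
move: xH; rewrite -{1}yHE => /imsetP[h hH ->].
by rewrite mulrC mulKf.
Qed.

(* With M the nonzero multipliers of Q and N the translations preserving Q,
   one has M N <= N, so that the elements stabilising N multiplicatively form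
   a ring between Y and N <= Q; a finite ring contains the quotients. *)
Lemma quotient_set_subring Y : 0 \in Y -> 1 \in Y ->
  {in quotient_set Y, forall x, x + 1 \in quotient_set Y} ->
  {in Y & quotient_set Y, forall y x, y * x \in quotient_set Y} ->
  subring_set (quotient_set Y) /\ Y \subset quotient_set Y.
Proof.
move=> Y0 Y1 Qadd Qmul; set Q := quotient_set Y in Qadd Qmul *.
have YQ y : y \in Y -> y \in Q.
  by move=> yY; apply/quotientP; exists y, 0, 1, 0; split; rewrite ?oner_eq0 // !subr0 divr1.
have QN x : x \in Q -> - x \in Q.
  move=> /quotientP[a [b [c [d [[aY bY cY dY] cd ->]]]]]; apply/quotientP.
  by exists b, a, c, d; split=> //; rewrite -mulNr opprB.
have QV x : x \in Q -> x^-1 \in Q.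
  move=> /quotientP[a [b [c [d [[aY bY cY dY] cd ->]]]]].
  have [->|ab] := eqVneq a b; first by rewrite subrr mul0r invr0 YQ.
  by apply/quotientP; exists c, d, a, b; split=> //; rewrite invfM invrK mulrC.
pose N := [set n | [forall x in Q, x + n \in Q]].
have NP n x : n \in N -> x \in Q -> x + n \in Q.
  by rewrite inE => /forall_inP; apply.
have N0 : 0 \in N by rewrite inE; apply/forall_inP => x xQ; rewrite addr0.
have N1 : 1 \in N by rewrite inE; apply/forall_inP.
have NB : {in N &, forall m n, m - n \in N}.
  move=> m n mN nN; rewrite inE; apply/forall_inP=> x xQ.
  have := QN _ (NP _ _ nN (QN _ (NP _ _ mN xQ))).
  by rewrite opprD opprK addrA.
have NQ n : n \in N -> n \in Q by move=> nN; rewrite -[n]add0r NP // YQ.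
(* [x + y n = y (x / y + n)], and [x / y] is in [Q] because it is the inverse of [y x^-1]. *)
have YN y n : y \in Y -> n \in N -> y * n \in N.
  move=> yY nN; have [->|y0] := eqVneq y 0; first by rewrite mul0r.
  rewrite inE; apply/forall_inP=> x xQ.
  have xyQ : x / y \in Q by rewrite -[x / y]invrK QV // invfM invrK mulrC Qmul ?QV.
  by rewrite -[x](divfK y0) mulrC -mulrDr Qmul // NP // mulrC.
pose H := [set h | [forall n in N, h * n \in N]].
have HP h n : h \in H -> n \in N -> h * n \in N by rewrite inE => /forall_inP; apply.
have HN h : h \in H -> h \in N by move=> hH; rewrite -[h]mulr1 HP.
have Hring : subring_set H.
  split; first by rewrite inE; apply/forall_inP=> n; rewrite mul1r.
    move=> g h gH hH; rewrite inE; apply/forall_inP=> n nN.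
    by rewrite mulrBl NB // HP.
  move=> g h gH hH; rewrite inE; apply/forall_inP=> n nN.
  by rewrite -mulrA HP // HP.
have YH y : y \in Y -> y \in H.
  by move=> yY; rewrite inE; apply/forall_inP=> n; apply: YN.
have QH : Q = H.
  apply/setP=> x; apply/idP/idP => [|/HN/NQ//].
  move=> /quotientP[a [b [c [d [[aY bY cY dY] cd ->]]]]].
  by have [_ HB _] := Hring; rewrite subring_div // HB // YH.
by rewrite QH; split=> //; apply/subsetP.
Qed.

Definition submodule_set G W :=
  [/\ 0 \in W, {in W &, forall x y, x - y \in W} & {in G & W, forall g x, g * x \in W}].

(** The sum is direct: a coincidence gives [w' - w = (g - g') v] with [g != g'], and dividing by
    [g - g'] in [G] puts [v] into [W]. *)
Lemma card_add_line G W v : subring_set G -> submodule_set G W -> v \notin W ->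
  #|sumset W (dilate v G)| = (#|W| * #|G|)%N /\ submodule_set G (sumset W (dilate v G)).
Proof.
move=> Gring [W0 WB WM] vW; have [G1 GB GM] := Gring.
have G0 : 0 \in G by rewrite -(subrr 1) GB.
split; last first.
  split.
  - by rewrite -[0]addr0 mem_sumset // -(mulr0 v) mem_dilate.
  - move=> x y /imset2P[w z wW zv ->] /imset2P[w' z' wW' zv' ->].
    move: zv zv' => /imsetP[g gG ->] /imsetP[g' gG' ->].
    rewrite opprD addrACA -mulrBr; apply: mem_sumset; first exact: WB.
    by rewrite mem_dilate // GB.
  - move=> g x gG /imset2P[w z wW /imsetP[h hG ->] ->].
    by rewrite mulrDr mem_sumset ?WM // mulrCA mem_dilate // GM.
pose f (u : F * F) := u.1 + v * u.2.
have finj : {in setX W G &, injective f}.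
  move=> [w g] [w' g'] /setXP[/= wW gG] /setXP[/= wW' gG']; rewrite /f /= => e.
  have e' : w' - w = (g - g') * v.
    by rewrite mulrBl -[w'](addrK (v * g')) -e; ring.
  have [gE|ne] := eqVneq g g'.
    by move/eqP: e'; rewrite gE subrr mul0r subr_eq0 => /eqP->.
  case/negP: vW.
  have gg0 : g - g' != 0 by rewrite subr_eq0.
  rewrite -[v](mulKf gg0) -e' WM // ?WB // -[_^-1]mul1r.
  by apply: subring_div => //; apply: GB.
rewrite -cardsX -(card_in_imset finj); apply: eq_card => x.
apply/imset2P/imsetP => [[w _ wW /imsetP[g gG ->] ->]|[[w g] /setXP[/= wW gG] ->]].
  by exists (w, g); rewrite ?inE /= ?wW.
by exists w (v * g); rewrite ?mem_dilate.
Qed.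

(** Greedy construction of a basis of the field over [G]: while [W] misses some [v], adding [v G]
    multiplies its size by [|G|] and shrinks the complement, on which the induction runs. *)
Lemma card_subring_pow G : subring_set G -> exists d, #|F| = (#|G| ^ d)%N.
Proof.
move=> Gring.
suff IH m W k : submodule_set G W -> #|W| = (#|G| ^ k)%N -> (#|~: W| <= m)%N ->
    exists d, #|F| = (#|G| ^ d)%N.
  apply: (IH #|F| [set 0] 0%N); last by rewrite max_card.
    split; first by rewrite inE.
      by move=> x y; rewrite !inE => /eqP-> /eqP->; rewrite subrr.
    by move=> g x _; rewrite !inE => /eqP->; rewrite mulr0.
  by rewrite cards1.
elim: m W k => [|m IHm] W k Wmod Wk Wm.
  exists k; rewrite -Wk -cardsT; congr #|pred_of_set _|.
  apply/esym; rewrite -[W]setCK (cards0_eq (_ : #|~: W| = 0)%N) ?setC0 //.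
  by apply/eqP; rewrite -leqn0.
have [WT|[v]] := set_0Vmem (~: W).
  by exists k; rewrite -Wk -cardsT; congr #|pred_of_set _|; rewrite -[W]setCK WT setC0.
rewrite inE => vW; have [Wc Wmod'] := card_add_line Gring Wmod vW.
apply: (IHm _ k.+1 Wmod'); first by rewrite Wc Wk expnSr.
have [G1 _ _] := Gring; have [W0 _ _] := Wmod.
rewrite -ltnS; apply: leq_trans Wm; apply: proper_card; rewrite properE; apply/andP; split.
  apply/subsetP=> x; rewrite !inE; apply: contraNN => xW.
  rewrite -[x]addr0 mem_sumset // -(mulr0 v) mem_dilate //.
  by have [_ GB _] := Gring; rewrite -(subrr 1) GB.
apply/negP=> /subsetP/(_ v); rewrite !inE vW => /(_ isT)/negP; apply.
by rewrite -[v in X in X \in _]add0r mem_sumset // -{1}(mulr1 v) mem_dilate.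
Qed.

(** [H] equals the span of its own elements over ['F_p], because scalars of ['F_p] act as natural
    multiples. *)
Lemma subfield_of_subring p (charFp : p \in [pchar F]) H : subring_set H ->
  exists S : {subfield fieldExt_of charFp}, subfield_set S = H.
Proof.
move=> [H1 HB HM].
have H0 : 0 \in H by rewrite -(subrr 1) HB.
have HD x y : x \in H -> y \in H -> x + y \in H.
  by move=> xH yH; rewrite -[y]opprK HB // -sub0r HB.
pose L := fieldExt_of charFp.
pose s : seq L := enum H.
have memV (x : L) : (x \in <<s>>%VS) = ((x : F) \in H).
  apply/idP/idP => [xs|xH]; last by apply: memv_span; rewrite mem_enum.
  rewrite (coord_span (X := in_tuple s) xs).
  apply: (big_ind (fun x : L => (x : F) \in H)) => // i _.
  have : (in_tuple s)`_i \in s by apply: mem_nth.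
  rewrite mem_enum; move: (coord _ _ _) (nth _ _ _) => k y yH.
  have -> : k *: y = (k%:R : F) * (y : F) by [].
  apply: HM => //; elim: (nat_of_ord k) => [|j IH]; first by rewrite mulr0n.
  by rewrite mulrSr HD.
have Valg : is_aspace <<s>>%VS.
  rewrite /is_aspace has_algid1 ?memV //=; apply/prodvP => u v.
  by rewrite !memV; apply: HM.
by exists (ASpace Valg); apply/setP=> x; rewrite inE memV.
Qed.

End Quotients.

Section Expansion.
Variables (F : finFieldType) (R : realFieldType) (kappa : R) (A Y : {set F}).
Hypotheses (k1 : 1 <= kappa) (An0 : A != set0) (Y0 : 0 \in Y) (Y1 : 1 \in Y).
Hypothesis YA : {in Y, forall y, dilate_bounded kappa A y}.

Lemma energy_quotient xi : xi \in quotient_set Y ->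
  #|A|%:R ^+ 3 <= (4 * kappa) ^+ 4 * (energy_dilate A xi)%:R.
Proof.
move=> /quotientP[a [b [c [d [[aY bY cY dY] cd ->]]]]].
have := @energy_dilate_comb F R kappa A [:: a] [:: b] [:: c] [:: d] An0.
rewrite !big_seq1 subr_eq0; apply=> // x.
by rewrite !inE => /or4P[] /eqP->; apply: YA.
Qed.

Lemma bounded2 x y : x \in Y -> y \in Y -> dilate_bounded (kappa ^+ 2) A (x * y).
Proof. by move=> xY yY; rewrite expr2; apply: dilate_boundedM => //; apply: YA. Qed.

Lemma bounded3 x y z : x \in Y -> y \in Y -> z \in Y ->
  dilate_bounded (kappa ^+ 3) A (x * y * z).
Proof.
move=> xY yY zY; rewrite exprSr; apply: dilate_boundedM => //.
- by rewrite exprn_ege1.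
- exact: bounded2.
- exact: YA.
Qed.

(** [W = Y + rho Y] has more than [q] pairs, so [w1 - xi w2] takes some value twice; solving the
    collision for [xi] gives the quotient. Its denominator is nonzero, as [w2 = w4] would force
    [w1 = w3]. *)
Lemma new_element_collision rho xi : rho \notin quotient_set Y -> (#|F| < #|Y| ^ 4)%N ->
  exists y1 y2 y3 y4 z1 z2 z3 z4,
   [/\ [/\ y1 \in Y, y2 \in Y, y3 \in Y & y4 \in Y],
       [/\ z1 \in Y, z2 \in Y, z3 \in Y & z4 \in Y],
       y2 - y4 + rho * (z2 - z4) != 0 &
       xi = (y1 - y3 + rho * (z1 - z3)) / (y2 - y4 + rho * (z2 - z4))].
Proof.
move=> rhoQ qY.
pose f (u : F * F) := u.1 + rho * u.2.
have finj : {in setX Y Y &, injective f}.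
  move=> [y z] [y' z'] /setXP[/= yY zY] /setXP[/= yY' zY']; rewrite /f /= => e.
  have e' : y' - y = rho * (z - z') by rewrite -[y'](addrK (rho * z')) -e; ring.
  have [zE|ne] := eqVneq z z'.
    by move/eqP: e'; rewrite zE subrr mulr0 subr_eq0 => /eqP->.
  case/negP: rhoQ; apply/quotientP; exists y', y, z, z'; split=> //.
  by rewrite e' mulfK // subr_eq0.
pose W := f @: setX Y Y.
have Wcard : #|W| = (#|Y| ^ 2)%N by rewrite card_in_imset // cardsX mulnn.
pose g (u : F * F) := u.1 - xi * u.2.
have : ~~ [forall u in setX W W, forall v in setX W W, (g u == g v) ==> (u == v)].
  apply/negP => ginj; have := max_card [in g @: setX W W].
  rewrite card_in_imset; first by rewrite cardsX Wcard -expnD leqNgt qY.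
  move=> u v uW vW /eqP guv; apply/eqP.
  by move: ginj => /forall_inP/(_ u uW)/forall_inP/(_ v vW)/implyP/(_ guv).
rewrite negb_forall_in => /exists_inP[[w1 w2] wW]; rewrite negb_forall_in.
move=> /exists_inP[[w3 w4] wW']; rewrite negb_imply => /andP[/eqP guv neq].
move: wW wW'; rewrite !in_setX /=.
move=> /andP[/imsetP[[y1 z1] /setXP[/= y1Y z1Y] w1E] /imsetP[[y2 z2] /setXP[/= y2Y z2Y] w2E]].
move=> /andP[/imsetP[[y3 z3] /setXP[/= y3Y z3Y] w3E] /imsetP[[y4 z4] /setXP[/= y4Y z4Y] w4E]].
rewrite /f /= in w1E w2E w3E w4E; rewrite /g /= in guv.
have e : w1 - w3 = xi * (w2 - w4).
  by rewrite mulrBr -[w1](subrK (xi * w2)) guv; ring.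
have e2 : y2 - y4 + rho * (z2 - z4) = w2 - w4 by rewrite w2E w4E; ring.
have e1 : y1 - y3 + rho * (z1 - z3) = w1 - w3 by rewrite w1E w3E; ring.
have w24 : w2 - w4 != 0.
  apply: contraNneq neq => w24; move/eqP: (w24); rewrite subr_eq0 => /eqP->.
  by move: e; rewrite w24 mulr0 => /eqP; rewrite subr_eq0 => /eqP->.
exists y1, y2, y3, y4, z1, z2, z3, z4; split=> //; first by rewrite e2.
by rewrite e1 e2 e mulfK.
Qed.

(* If the quotient set is not a ring, some rho outside it makes Y + rho Y have
   |Y| ^ 2 elements, and then every xi is a quotient of differences of
   Y + rho Y: a ratio of sums of 12 quadratic (rho = r + 1) or 8 cubic
   (rho = y r) monomials in Y, up to sign. *)
Lemma energy_or_subring : (#|F| < #|Y| ^ 4)%N ->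
  (subring_set (quotient_set Y) /\ Y \subset quotient_set Y) \/
  forall xi, #|A|%:R ^+ 3 <= (24 * kappa ^+ 2) ^+ 24 * (energy_dilate A xi)%:R.
Proof.
move=> qY; set Q := quotient_set Y.
have [Qadd|/forall_inPn[r rQ r1Q]] := boolP [forall x in Q, x + 1 \in Q]; last first.
  right=> xi.
  have [y1 [y2 [y3 [y4 [z1 [z2 [z3 [z4 [[y1Y y2Y y3Y y4Y] [z1Y z2Y z3Y z4Y] d0 xiE]]]]]]]]] :=
    new_element_collision xi r1Q qY.
  have [a [b [c [d [[aY bY cY dY] cd rE]]]]] := quotientP _ _ rQ.
  have cd0 : c - d != 0 by rewrite subr_eq0.
  (* After multiplication by the denominator [c - d] of [r], six positive and six negative monomials
     stand in each of numerator and denominator: 24 in all. *)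
  pose P y y' z z' := [:: c * y; d * y'; a * z; c * z; b * z'; d * z'].
  pose M y y' z z' := [:: d * y; c * y'; b * z; d * z; a * z'; c * z'].
  have PM y y' z z' : \sum_(x <- P y y' z z') x - \sum_(x <- M y y' z z') x =
      (c - d) * (y - y' + (r + 1) * (z - z')).
    by rewrite /P /M !big_cons !big_nil rE; field.
  have := @energy_dilate_comb F R (kappa ^+ 2) A (P y1 y3 z1 z3) (M y1 y3 z1 z3)
    (P y2 y4 z2 z4) (M y2 y4 z2 z4) An0.
  rewrite !PM -mulf_div divff // mul1r -xiE; apply.
    move=> x; rewrite !mem_cat /P /M !inE -!orbA.
    by do ![case/orP=> [/eqP->|]; first exact: bounded2]; move/eqP->; apply: bounded2.
  by rewrite mulf_neq0.
have [Qmul|] := boolP [forall y in Y, forall x in Q, y * x \in Q].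
  left; apply: quotient_set_subring => //; first exact: (forall_inP Qadd).
  by move=> y x yY xQ; move/forall_inP: Qmul => /(_ y yY)/forall_inP; apply.
move=> /forall_inPn[y yY] /forall_inPn[r rQ yrQ]; right=> xi.
have [y1 [y2 [y3 [y4 [z1 [z2 [z3 [z4 [[y1Y y2Y y3Y y4Y] [z1Y z2Y z3Y z4Y] d0 xiE]]]]]]]]] :=
  new_element_collision xi yrQ qY.
have [a [b [c [d [[aY bY cY dY] cd rE]]]]] := quotientP _ _ rQ.
have cd0 : c - d != 0 by rewrite subr_eq0.
(* The factors 1 make all 16 monomials cubic, so that one bound serves them all. *)
pose P y' y'' z z' := [:: 1 * c * y'; 1 * d * y''; y * a * z; y * b * z'].
pose M y' y'' z z' := [:: 1 * d * y'; 1 * c * y''; y * b * z; y * a * z'].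
have PM y' y'' z z' : \sum_(x <- P y' y'' z z') x - \sum_(x <- M y' y'' z z') x =
    (c - d) * (y' - y'' + (y * r) * (z - z')).
  by rewrite /P /M !big_cons !big_nil rE; field.
have := @energy_dilate_comb F R (kappa ^+ 3) A (P y1 y3 z1 z3) (M y1 y3 z1 z3)
  (P y2 y4 z2 z4) (M y2 y4 z2 z4) An0.
rewrite !PM -mulf_div divff // mul1r -xiE => bound.
apply: le_trans (bound _ _) _.
- move=> x; rewrite !mem_cat /P /M !inE -!orbA.
  by do ![case/orP=> [/eqP->|]; first exact: bounded3]; move/eqP->; apply: bounded3.
- by rewrite mulf_neq0.
(* Both sides carry [kappa ^+ 48]; only the numerical factors differ. *)
apply: ler_wpM2r => //; change ((16 * kappa ^+ 3) ^+ 16 <= (24 * kappa ^+ 2) ^+ 24).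
rewrite ![(_ * _ ^+ _) ^+ _]exprMn -[kappa ^+ 3 ^+ 16]exprM -[kappa ^+ 2 ^+ 24]exprM.
have k0 : 0 <= kappa by rewrite (le_trans _ k1).
have p16 : 16 ^+ 16 <= 24 ^+ 16 :> R by rewrite lerXn2r ?nnegrE ?ler_nat // ler0n.
have p24 : 24 ^+ 16 <= 24 ^+ 24 :> R by rewrite ler_weXn2l // ler1n.
rewrite (_ : (3 * 16 = 2 * 24)%N) //.
by apply: ler_wpM2r; [apply: exprn_ge0 | apply: le_trans p24].
Qed.

End Expansion.

(** * The plane spanned by the rich directions *)

Section RichPlane.
Variables (F : finFieldType) (R : realFieldType) (kappa : R) (A G : {set F}).
Hypotheses (k1 : 1 <= kappa) (An0 : A != set0) (Gring : subring_set G).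
Hypothesis GA : {in G, forall xi, #|A|%:R ^+ 3 <= kappa * (energy_dilate A xi)%:R}.
Hypothesis AA : #|sumset A (oppset A)|%:R <= kappa * #|A|%:R.

Let k0 : 0 < kappa. Proof. exact: lt_le_trans k1. Qed.
Let G0 : 0 \in G. Proof. by have [G1 GB _] := Gring; rewrite -(subrr 1) GB. Qed.

Lemma card_sumset_rich v : v \in rich kappa A G ->
  #|sumset A (dilate v G)|%:R <= 64 * kappa ^+ 3 * #|A|%:R.
Proof.
have [_ GB _] := Gring.
rewrite inE => /andP[v0 vrich]; apply: card_sumset_subgroup => //.
- by rewrite -(mulr0 v) mem_dilate.
- move=> x y /imsetP[g gG ->] /imsetP[h hG ->].
  by rewrite -mulrBr mem_dilate // GB.
- by rewrite card_dilate.
Qed.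

Lemma card_sum_rich (vs : seq F) : (size vs <= 3)%N ->
  {subset vs <= rich kappa A G} ->
  #|sumsets [seq dilate v G | v <- vs]|%:R <= (3 * (64 * kappa ^+ 3)) ^+ 3 * #|A|%:R.
Proof.
move=> size3 vsrich; have := @card_sumsets F R (64 * kappa ^+ 3) A
  [seq dilate v G | v <- vs] [::] An0.
rewrite cats0 [sumsets [::]]/= /oppset imset_set1 oppr0 sumset0 addn0 size_map => bound.
apply: le_trans (bound _) _.
  by move=> B /mapP[v /vsrich vr ->]; apply: card_sumset_rich.
apply: ler_wpM2r => //.
have p1 : 1 <= 64 * kappa ^+ 3 by rewrite mulr_ege1 ?exprn_ege1 // ler1n.
have p0 : 0 <= 64 * kappa ^+ 3 by rewrite (le_trans _ p1).
apply: le_trans (_ : (3 * (64 * kappa ^+ 3)) ^+ size vs <= _).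
  by apply: lerXn2r; rewrite ?nnegrE ?(mulr_ge0 (ler0n _ _) p0) // ler_wpM2r // ler_nat.
by rewrite ler_weXn2l // mulr_ege1 // ler1n.
Qed.

Lemma submodule_set0 : submodule_set G [set 0].
Proof.
split; first by rewrite inE.
  by move=> x y; rewrite !inE => /eqP-> /eqP->; rewrite subrr.
by move=> g x _; rewrite !inE => /eqP->; rewrite mulr0.
Qed.

(* The rich directions cannot span too much: each line in a rich direction
   can be added to A at bounded cost, whereas A is small compared with F. *)
Lemma rich_plane d : #|F| = (#|G| ^ d)%N -> (d <= 3)%N ->
  4 * kappa <= #|A|%:R -> 2 * kappa * #|G|%:R < #|A|%:R ->
  (3 * (64 * kappa ^+ 3)) ^+ 3 * #|A|%:R < #|F|%:R ->
  d = 3%N /\ exists b v1 v2, [/\ b \in A, v1 != 0, v2 \notin dilate v1 G &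
    #|A|%:R <= 2 * kappa *
      #|[set a in A | a - b \in sumset (dilate v1 G) (dilate v2 G)]|%:R].
Proof.
move=> Fd d3 Abig AG Asmall.
have [b bA Ab] := rich_differences k0 An0 G0 GA Abig.
set D := rich kappa A G in Ab.
have Gb : (#|G| < #|[set a in A | (a - b)%R \in D]|)%N.
  by rewrite -(ltr_nat R) -(ltr_pM2l (_ : 0 < 2 * kappa)) ?mulr_gt0 // (lt_le_trans AG).
have [a1] : exists a1, a1 \in [set a in A | a - b \in D].
  by apply/set0Pn; rewrite -card_gt0 (leq_ltn_trans _ Gb).
rewrite inE => /andP[_]; set v1 := a1 - b => v1D.
have v10 : v1 != 0 by move: v1D; rewrite inE => /andP[].
(* More than [|G|] points have a rich difference from [b], too many for the single line
   [b + v1 G]. *)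
have [a2 a2D a2G] : exists2 a, a \in [set a in A | a - b \in D] & a - b \notin dilate v1 G.
  apply/exists_inP; rewrite -[X in is_true X]negbK negb_exists_in; apply/negP=> /forall_inP all1.
  move: Gb; rewrite ltnNge => /negP; apply; rewrite -(card_dilate G v10).
  rewrite -(card_sumset1 (dilate v1 G) b); apply/subset_leq_card/subsetP=> a /all1.
  by rewrite negbK => h; rewrite -(subrK b a) mem_sumset ?inE.
move: a2D a2G; rewrite inE => /andP[_]; set v2 := a2 - b => v2D v2G.
pose W1 := sumset [set 0] (dilate v1 G).
have W1E : W1 = dilate v1 G by rewrite /W1 sumsetC sumset0.
have v1n : v1 \notin [set 0] by rewrite inE.
have [W1c W1m] := card_add_line Gring submodule_set0 v1n.
have v2n : v2 \notin W1 by rewrite W1E.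
have [W2c W2m] := card_add_line Gring W1m v2n.
have bound vs : (size vs <= 3)%N -> {subset vs <= D} ->
    (#|sumsets [seq dilate v G | v <- vs]| < #|F|)%N.
  by move=> s3 sD; rewrite -(ltr_nat R); apply: le_lt_trans Asmall; apply: card_sum_rich.
(* Two independent lines already sum to [|G|^2] elements, which must be fewer than [q = |G|^d]. *)
have dE : d = 3%N.
  have : (#|sumsets [seq dilate v G | v <- [:: v1; v2]]| < #|F|)%N.
    by apply: bound => // v; rewrite !in_cons in_nil orbF => /orP[] /eqP->.
  have Gpos : (0 < #|G|)%N by rewrite card_gt0; apply/set0Pn; exists 0.
  rewrite /= sumset0 -W1E W2c W1c cards1 mul1n Fd => lt.
  case: d d3 {Fd} lt => [|[|[|[|]]]] // _.
  - by rewrite expn0 ltnS leqNgt muln_gt0 Gpos.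
  - by rewrite expn1 ltnNge leq_pmulr.
  - by rewrite mulnn ltnn.
split=> //; exists b, v1, v2; split=> //.
apply: le_trans Ab _; rewrite ler_pM2l ?mulr_gt0 // ler_nat.
apply/subset_leq_card/subsetP=> a; rewrite inE => /andP[aA v3D].
(* A rich direction outside the plane would give a sum of three lines with [|G|^3 = q] elements. *)
rewrite inE aA /=; set v3 := a - b in v3D *; apply/negPn/negP=> v3n.
have v3n' : v3 \notin sumset W1 (dilate v2 G) by rewrite W1E.
have [W3c _] := card_add_line Gring W2m v3n'.
have : (#|sumsets [seq dilate v G | v <- [:: v1; v2; v3]]| < #|F|)%N.
  by apply: bound => // v; rewrite !in_cons in_nil orbF => /or3P[] /eqP->.
rewrite /= sumset0 sumsetA -W1E W3c W2c W1c cards1 mul1n Fd dE.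
by rewrite !expnS expn0 muln1 mulnA ltnn.
Qed.

End RichPlane.

Lemma plane_of_subfield (F : finFieldType) (p : nat) (charFp : p \in [pchar F])
    (S : {subfield fieldExt_of charFp}) (v1 v2 : F) :
  v1 != 0 -> v2 \notin dilate v1 (subfield_set S) ->
  exists V : {vspace fieldOver S}, \dim V = 2%N /\
    sumset (dilate v1 (subfield_set S)) (dilate v2 (subfield_set S)) \subset subspace_set V.
Proof.
move=> v10 v2n.
pose w1 : fieldOver S := v1; pose w2 : fieldOver S := v2.
exists <<[:: w2; w1]>>%VS; split.
  (* Freeness is by definition this equality of dimension; with [w2] first, [free_cons] asks that
     [v2] avoid the line of [v1]. *)
  apply/eqP; rewrite -[_ == _]/(free [:: w2; w1]) free_cons span_seq1 seq1_free.
  apply/andP; split=> //.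
  apply: contraNN v2n => /vlineP[k /= e]; apply/imsetP; exists (vsval k).
    by rewrite inE; apply: subvsP.
  rewrite mulrC; exact: e.
apply/subsetP=> x /imset2P[y z /imsetP[g gS ->] /imsetP[h hS ->] ->].
rewrite inE.
have memS (w : fieldOver S) (k : F) : k \in subfield_set S -> w \in <<[:: w2; w1]>>%VS ->
    ((w : F) * k : fieldOver S) \in <<[:: w2; w1]>>%VS.
  rewrite inE => kS wV.
  have -> : ((w : F) * k : fieldOver S) = (Subvs kS : subvs_of S) *: w.
    by rewrite mulrC.
  exact: rpredZ.
apply: rpredD; apply: memS => //; apply: memv_span; rewrite !inE eqxx ?orbT //.
Qed.

(** * Numerical inequalities in powers of [s = q^(1/6)] *)

Section Numerics.
Variables (R : realFieldType) (c1 c2 c3 C K s n m : R).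
Hypotheses (c1_ge1 : 1 <= c1) (c2_ge1 : 1 <= c2) (c3_ge1 : 1 <= c3).
Hypotheses (Cc1 : (2 * c1) ^+ 3 <= C) (Cc2 : c2 ^+ 3 <= C) (Cc3 : 48 * c3 <= C)
  (C1 : 1 <= C).
Hypotheses (K1 : 1 <= K) (s0 : 0 < s).
Hypotheses (Ks : C * K ^+ 1504 < s ^+ 3) (sn : C * s ^+ 3 * K ^+ 85 <= n)
  (ns : n <= s ^+ 4) (nm : n <= 12 * K * m) (mn : m <= n).

Let K0 : 0 < K. Proof. exact: lt_le_trans K1. Qed.
Let C0 : 0 < C. Proof. exact: lt_le_trans C1. Qed.
Let ltP : 0 < s ^+ 3. Proof. exact: exprn_gt0. Qed.

Let KX e : 0 < K ^+ e. Proof. exact: exprn_gt0. Qed.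
Let KX1 e : 1 <= K ^+ e. Proof. exact: exprn_ege1. Qed.
(** Compared after cubing, since [(s^2)^3 = (s^3)^2] and [K^1504] is controlled by [s^3]; this is
    where exponents are limited to two thirds of 1504. *)
Lemma power_lt_s2 c e : (e * 3 <= 1504 * 2)%N -> 1 <= c -> c ^+ 3 <= C ->
  c * K ^+ e < s ^+ 2.
Proof.
move=> e3 cge1 cC; have cpos : 0 < c by apply: lt_le_trans cge1.
have cK : 0 <= c * K ^+ e by rewrite mulr_ge0 // ltW.
rewrite -(@ltr_pXn2r _ 3) ?nnegrE ?exprn_ge0 ?(ltW s0) //.
have -> : s ^+ 2 ^+ 3 = s ^+ 3 ^+ 2 by rewrite -!exprM.
apply: le_lt_trans (_ : (C * K ^+ 1504) ^+ 2 < _); last first.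
  by rewrite ltr_pXn2r ?nnegrE ?(ltW ltP) // mulr_ge0 // ltW.
rewrite [(c * _) ^+ 3]exprMn [(C * _) ^+ 2]exprMn -!exprM.
apply: ler_pM; rewrite ?exprn_ge0 ?(ltW cpos) ?(ltW K0) //.
  by rewrite (le_trans cC) // expr2 ler_peMl // ltW.
by rewrite ler_weXn2l.
Qed.

(** Passing from [A] to [A'] costs [12 * K], which turns [K^85] into [K^84] and [48 * c3] into
    [4 * c3]. *)
Lemma m_large : 4 * c3 * s ^+ 3 * K ^+ 84 <= m.
Proof.
have K12 : 0 < 12 * K by rewrite mulr_gt0.
have h := le_trans sn nm.
rewrite -(ler_pM2l K12); apply: le_trans h.
have -> : 12 * K * (4 * c3 * s ^+ 3 * K ^+ 84) = (48 * c3) * (s ^+ 3 * K ^+ 85).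
  by rewrite (exprS K 84); ring.
by rewrite -[leRHS]mulrA ler_wpM2r // mulr_ge0 // ltW.
Qed.

Let s3_ge1 : 1 <= s ^+ 3.
Proof. by apply: le_trans (ltW Ks); rewrite mulr_ege1. Qed.

Let s3_le_m : s ^+ 3 <= m.
Proof.
apply: le_trans m_large.
rewrite [leRHS](_ : _ = 4 * c3 * K ^+ 84 * s ^+ 3); last by ring.
by rewrite ler_peMl ?(ltW ltP) // mulr_ege1 // mulr_ege1 // ler1n.
Qed.

Lemma growth_lt_q c e : (e * 3 <= 1504 * 2)%N -> 1 <= c -> c ^+ 3 <= C ->
  c * K ^+ e * m < s ^+ 6.
Proof.
move=> e3 cge1 cC; have lt2 := power_lt_s2 e3 cge1 cC.
have m0 : 0 < m by apply: lt_le_trans s3_le_m.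
apply: lt_le_trans (_ : s ^+ 2 * m <= _); first by rewrite ltr_pM2r.
rewrite (exprD s 2 4) ler_pM2l ?exprn_gt0 //; exact: le_trans mn ns.
Qed.

Lemma all_xi_lt_q : 2 * (c1 * K ^+ 912) * m < s ^+ 6.
Proof.
by rewrite [2 * _]mulrA; apply: growth_lt_q; rewrite // mulr_ege1 // ler1n.
Qed.

Lemma all_xi_lt_m : 2 * (c1 * K ^+ 912) < m.
Proof.
apply: lt_le_trans s3_le_m; apply: le_lt_trans Ks; rewrite mulrA.
have c1_2 : 1 <= 2 * c1 by rewrite mulr_ege1 // ler1n.
apply: ler_pM; [exact: le_trans c1_2 | exact: ltW | | by rewrite ler_weXn2l].
by apply: le_trans Cc1; rewrite -[leLHS]expr1 ler_weXn2l.
Qed.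

Lemma rich_sum_lt_q : c2 * K ^+ 684 * m < s ^+ 6.
Proof. exact: growth_lt_q. Qed.

Lemma line_lt_m : 2 * (c3 * K ^+ 76) * s ^+ 3 < m.
Proof.
apply: lt_le_trans m_large; have c30 : 0 < c3 by apply: lt_le_trans c3_ge1.
rewrite [ltRHS](_ : _ = 2 * (c3 * (2 * K ^+ 84)) * s ^+ 3); last by ring.
rewrite ltr_pM2r // ltr_pM2l // ltr_pM2l //.
apply: le_lt_trans (_ : K ^+ 84 < _); first by rewrite ler_weXn2l.
by rewrite ltr_pMl // ltr1n.
Qed.

Lemma four_kappa_le_m : 4 * (c3 * K ^+ 76) <= m.
Proof.
apply: le_trans m_large; have c30 : 0 < c3 by apply: lt_le_trans c3_ge1.
rewrite [leRHS](_ : _ = 4 * (c3 * (s ^+ 3 * K ^+ 84))); last by ring.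
rewrite ler_pM2l // ler_pM2l // -[leLHS]mul1r.
by apply: ler_pM; rewrite ?(ltW (KX _)) // ler_weXn2l.
Qed.

Lemma conclusion_le x : 0 <= x -> m <= 2 * (c3 * K ^+ 76) * x -> n <= C * K ^+ 85 * x.
Proof.
move=> x0 mx; have c30 : 0 < c3 by apply: lt_le_trans c3_ge1.
apply: le_trans nm _; apply: le_trans (_ : 12 * K * (2 * (c3 * K ^+ 76) * x) <= _).
  by rewrite ler_pM2l // mulr_gt0.
have -> : 12 * K * (2 * (c3 * K ^+ 76) * x) = (24 * c3) * K ^+ 77 * x.
  by rewrite (exprS K 76); ring.
apply: ler_wpM2r => //; apply: ler_pM; rewrite ?(ltW (KX _)) ?mulr_ge0 ?(ltW c30) //;
  last by rewrite ler_weXn2l.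
by apply: le_trans Cc3; rewrite ler_pM2r // ler_nat.
Qed.

End Numerics.

(** [a1] is determined by the other three entries. Against the energy hypothesis this trivial bound
    forces [K >= 1]. *)
Lemma energy_dilate_le_cube (F : finFieldType) (A : {set F}) xi :
  (energy_dilate A xi <= #|A| ^ 3)%N.
Proof.
pose g (t : F * F * F * F) : F * F * F := (t.1.1.2, t.1.2, t.2).
rewrite /energy_dilate; set E := [set t | _].
have ginj : {in E &, injective g}.
  move=> [[[a1 a2] a3] a4] [[[b1 b2] b3] b4]; rewrite !inE /=.
  move=> /and5P[_ _ _ _ /eqP e] /and5P[_ _ _ _ /eqP e'] [e2 e3 e4].
  by rewrite -[a1](subrK a2) e e2 e3 e4 -e' subrK.
rewrite -(card_in_imset ginj).
apply: leq_trans (_ : #|setX (setX A A) A| <= _)%N; last first.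
  by rewrite !cardsX !expnS expn0 muln1 mulnA.
apply/subset_leq_card/subsetP=> x /imsetP[[[[a1 a2] a3] a4] + ->].
by rewrite !inE /= => /and5P[_ -> -> -> _].
Qed.

(** * Assembly of subfield and plane, without logarithms or real powers *)

Section Main.
Variables (R : realFieldType) (F : finFieldType) (p : nat) (charFp : p \in [pchar F]).
Variables (A X : {set F}) (c0 C K s : R).
(** The numerical parts of three losses: [c1] for a ratio with arbitrary [xi], [c3] for a quotient
    of differences of [Y], [c2] for a sum of three rich lines. [c0] is a variable with an equation,
    which keeps the huge numerals opaque. *)
Let c1 := (24 * c0 ^+ 2) ^+ 24.
Let c3 := (4 * c0) ^+ 4.
Let c2 := (3 * (64 * c3 ^+ 3)) ^+ 3.
Hypotheses (c0E : c0 = 2 ^+ 54).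
Hypotheses (Cc1 : (2 * c1) ^+ 3 <= C) (Cc2 : c2 ^+ 3 <= C) (Cc3 : 48 * c3 <= C)
  (C14 : 2 ^+ 14 <= C).
Hypotheses (X0 : 0 \notin X) (K0 : 0 < K) (s0 : 0 < s) (sF : s ^+ 6 = #|F|%:R).
Hypotheses (XK : C * K ^+ 1504 <= #|X|%:R) (Xlow : C ^+ 2 * s ^+ 3 * K ^+ 8 <= #|X|%:R ^+ 2)
  (Xs : #|X|%:R < s ^+ 3) (Alow : C * s ^+ 3 * K ^+ 85 <= #|A|%:R)
  (Ahigh : #|A|%:R <= s ^+ 4).
Hypothesis energyX :
  forall xi, xi \in X -> #|A|%:R ^+ 3 / K <= (energy_dilate A xi)%:R.

Lemma plane_concentration :
  exists (S : {subfield fieldExt_of charFp}) (b : F) (V : {vspace fieldOver S}),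
    [/\ (#|subfield_set S| ^ 3 = #|F|)%N, b \in A, \dim V = 2%N &
        #|A|%:R <= C * K ^+ 85 * #|translate A b :&: subspace_set V|%:R].
Proof.
have C1 : 1 <= C by apply: le_trans C14; rewrite exprn_ege1 // ler1n.
have C0 : 0 < C by apply: lt_le_trans C1.
have Xpos : 0 < #|X|%:R :> R by apply: lt_le_trans XK; rewrite mulr_gt0 // exprn_gt0.
have Apos : 0 < #|A|%:R :> R by apply: lt_le_trans Alow; rewrite !mulr_gt0 ?exprn_gt0.
have Xn0 : X != set0 by rewrite -card_gt0 -(ltr0n R).
have An0 : A != set0 by rewrite -card_gt0 -(ltr0n R).
have K1 : 1 <= K.
  have [x xX] := set0Pn _ Xn0; have := energyX xX.
  rewrite ler_pdivrMr // => h.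
  have : (energy_dilate A x)%:R * K <= #|A|%:R ^+ 3 * K.
    by rewrite ler_pM2r // -natrX ler_nat energy_dilate_le_cube.
  move/(le_trans h); rewrite -[leLHS]mulr1 ler_pM2l // exprn_gt0 //.
have [A' [Y0 [sA Y01 nm XY YA']]] := common_dilates K0 An0 Xn0 X0 energyX.
pose m : R := #|A'|%:R; pose n : R := #|A|%:R.
have mn : m <= n by rewrite ler_nat subset_leq_card.
have mpos : 0 < m.
  have : 0 < 12 * K * m by apply: lt_le_trans nm.
  by rewrite pmulr_rgt0 // mulr_gt0.
have A'n0 : A' != set0 by rewrite -card_gt0 -(ltr0n R).
have Ks : C * K ^+ 1504 < s ^+ 3 by apply: le_lt_trans Xs.
have c0ge : 1 <= c0 by rewrite c0E exprn_ege1 // ler1n.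
have c1ge : 1 <= c1 by rewrite exprn_ege1 // mulr_ege1 ?exprn_ege1 // ler1n.
have c3ge : 1 <= c3 by rewrite exprn_ege1 // mulr_ege1 // ler1n.
have c2ge : 1 <= c2.
  by rewrite exprn_ege1 // mulr_ege1 ?ler1n // mulr_ege1 ?ler1n // exprn_ege1.
pose kappa := c0 * K ^+ 19.
have kappa1 : 1 <= kappa by rewrite mulr_ege1 // exprn_ege1.
pose Y := 0 |: Y0.
have Y1 : 1 \in Y by rewrite !inE Y01 orbT.
have Y0' : 0 \in Y by rewrite !inE eqxx.
have YA : {in Y, forall y, dilate_bounded kappa A' y}.
  move=> y; rewrite in_setU1 => /orP[/eqP->|yY]; first exact: dilate_bounded0.
  by rewrite /kappa c0E; apply: YA'.
(* [|X|] is at least [C q^(1/4) K^4] and at most [2^13 K^3 |Y0|], so [C >= 2^14] leaves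
   [|Y0| >= 2 q^(1/4)]. *)
have qY : (#|F| < #|Y| ^ 4)%N.
  have YY : #|Y0|%:R <= #|Y|%:R :> R by rewrite ler_nat subset_leq_card // subsetUr.
  set y : R := #|Y0|%:R in XY YY.
  have K6 : 0 < K ^+ 6 by rewrite exprn_gt0.
  have s3 : 0 < s ^+ 3 by rewrite exprn_gt0.
  have y0 : 0 <= y by rewrite ler0n.
  have h1 : C ^+ 2 * s ^+ 3 * K ^+ 8 <= (2 ^+ 13 * K ^+ 3 * y) ^+ 2.
    apply: le_trans Xlow _; apply: lerXn2r; rewrite ?nnegrE ?(ltW Xpos) //.
    by rewrite (le_trans (ltW Xpos)).
  have h2 : C ^+ 2 * s ^+ 3 * K ^+ 2 <= 2 ^+ 26 * y ^+ 2.
    rewrite -(ler_pM2r K6); apply: le_trans (_ : (2 ^+ 13 * K ^+ 3 * y) ^+ 2 <= _).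
      by apply: le_trans h1; rewrite -[leLHS]mulrA -exprD.
    by rewrite [leLHS](_ : _ = 2 ^+ 26 * y ^+ 2 * K ^+ 6) //; ring.
  have h3 : 2 ^+ 28 * s ^+ 3 <= C ^+ 2 * s ^+ 3 * K ^+ 2.
    rewrite -[leLHS]mulr1; apply: ler_pM; rewrite ?exprn_ege1 //.
      by rewrite mulr_ge0 ?exprn_ge0 // ltW.
    rewrite ler_pM2r // (_ : 2 ^+ 28 = (2 ^+ 14) ^+ 2); last by rewrite -exprM.
    by apply: lerXn2r; rewrite ?nnegrE ?exprn_ge0 // ltW.
  have h4 : 4 * s ^+ 3 <= y ^+ 2.
    by have := le_trans h3 h2; lra.
  rewrite -(ltr_nat R) natrX -sF; apply: lt_le_trans (_ : y ^+ 4 <= _); last first.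
    by apply: lerXn2r; rewrite ?nnegrE.
  rewrite (exprM s 3 2) (exprM y 2 2) ltr_pXn2r ?nnegrE ?exprn_ge0 ?(ltW s0) //.
  by apply: lt_le_trans h4; rewrite ltr_pMl // ltr1n.
have k24 : (24 * kappa ^+ 2) ^+ 24 = c1 * K ^+ 912.
  rewrite /kappa /c1 [(c0 * _) ^+ 2]exprMn mulrA [LHS]exprMn; congr (_ * _).
  by rewrite -[K ^+ 19 ^+ 2]exprM -exprM.
have lt_q := all_xi_lt_q c1ge c3ge Cc1 Cc3 C1 K1 s0 Ks Alow Ahigh nm mn.
have lt_m := all_xi_lt_m c1ge c3ge Cc1 Cc3 K1 s0 Ks Alow nm.
have no_growth k : 0 < k -> k <= c1 * K ^+ 912 ->
    ~ forall xi, m ^+ 3 <= k * (energy_dilate A' xi)%:R.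
  move=> k0 kle /(energy_all k0 A'n0) [].
    move=> le; suff lt : 2 * k * m < #|F|%:R by rewrite leNgt lt in le.
    rewrite -sF; apply: le_lt_trans lt_q; rewrite ler_pM2r // ler_pM2l //.
  move=> le; suff lt : 2 * k < m by rewrite leNgt lt in le.
  by apply: le_lt_trans lt_m; rewrite ler_pM2l.
have [|grow] := energy_or_subring kappa1 A'n0 Y0' Y1 YA qY; last first.
  case: (no_growth _ _ _ grow); last by rewrite k24.
  by rewrite exprn_gt0 // mulr_gt0 // exprn_gt0 // (lt_le_trans _ kappa1).
set G := quotient_set Y => -[Gring YG].
pose k4 := (4 * kappa) ^+ 4.
have k4E : k4 = c3 * K ^+ 76.
  by rewrite /k4 /kappa mulrA [LHS]exprMn -[K ^+ 19 ^+ 4]exprM.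
have k41 : 1 <= k4 by rewrite exprn_ege1 // mulr_ege1 // ler1n.
have GA : {in G, forall xi, m ^+ 3 <= k4 * (energy_dilate A' xi)%:R}.
  by move=> xi; apply: energy_quotient.
have AA : #|sumset A' (oppset A')|%:R <= k4 * m.
  have := YA 1 Y1; rewrite /dilate_bounded dilate1 => /le_trans; apply.
  apply: ler_wpM2r => //; apply: le_trans (_ : kappa ^+ 4 <= _).
    by rewrite -[leLHS]expr1 ler_weXn2l.
  have kap0 : 0 <= kappa by rewrite (le_trans _ kappa1).
  by apply: lerXn2r; rewrite ?nnegrE ?(mulr_ge0 _ kap0) // ler_peMl // ler1n.
have [d Fd] := card_subring_pow Gring.
have G4 : (#|F| < #|G| ^ 4)%N.
  by apply: leq_trans qY _; rewrite leq_exp2r // subset_leq_card.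
have Gpos : (0 < #|G|)%N.
  by rewrite card_gt0; apply/set0Pn; exists 0; rewrite (subsetP YG).
have d3 : (d <= 3)%N.
  by rewrite leqNgt; apply/negP=> d4; move: G4; rewrite Fd ltnNge leq_pexp2l.
(* Otherwise [G] is the whole field and the energy bound on [G] holds for every [xi], which
   [no_growth] excludes. *)
have d2 : (2 <= d)%N.
  rewrite ltnNge; apply/negP=> d1.
  have GT : G = [set: F].
    apply/eqP; rewrite eqEcard subsetT cardsT Fd -[leqRHS]expn1.
    by rewrite leq_pexp2l.
  case: (no_growth k4); first by rewrite (lt_le_trans _ k41).
    have c31 : c3 <= c1.
      have c00 : 0 <= c0 by rewrite (le_trans _ c0ge).
      apply: le_trans (_ : (24 * c0 ^+ 2) ^+ 4 <= _); last first.
        by rewrite ler_weXn2l // mulr_ege1 ?ler1n // exprn_ege1.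
      apply: lerXn2r; rewrite ?nnegrE ?mulr_ge0 ?exprn_ge0 //.
      by apply: ler_pM; rewrite ?ler_nat // expr2 ler_peMl.
    have c30 : 0 <= c3 by rewrite (le_trans _ c3ge).
    have K76 : K ^+ 76 <= K ^+ 912 by rewrite ler_weXn2l.
    by rewrite k4E; apply: ler_pM K76; rewrite // exprn_ge0 // ltW.
  by move=> xi; apply: GA; rewrite GT inE.
(* [d >= 2] means [|G| <= q^(1/2)], which is small enough against [A'] for two independent rich
   directions to exist. *)
have Gs : #|G|%:R <= s ^+ 3.
  rewrite -(@ler_pXn2r _ 2) ?nnegrE ?exprn_ge0 ?(ltW s0) // -exprM sF.
  by rewrite -natrX ler_nat Fd leq_pexp2l.
have [] := rich_plane k41 A'n0 Gring GA AA Fd d3.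
- by rewrite k4E; exact: four_kappa_le_m c3ge Cc3 C1 K1 s0 Ks Alow nm.
- rewrite k4E; apply: le_lt_trans (line_lt_m c3ge Cc3 K1 s0 Alow nm).
  by rewrite ler_pM2l // mulr_gt0 // -k4E (lt_le_trans _ k41).
- rewrite -sF (_ : (3 * (64 * k4 ^+ 3)) ^+ 3 = c2 * K ^+ 684).
    exact: rich_sum_lt_q c2ge c3ge Cc2 Cc3 C1 K1 s0 Ks Alow Ahigh nm mn.
  rewrite k4E (_ : 684 = 76 * 9)%N // exprM /c2.
  by move: c3 (K ^+ 76) => c u; ring.
move=> dE [b [v1 [v2 [bA v10 v2n mbig]]]].
have [S SG] := subfield_of_subring charFp Gring.
have v2n' : v2 \notin dilate v1 (subfield_set S) by rewrite SG.
have [V [dimV sV]] := plane_of_subfield v10 v2n'.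
exists S, b, V; split=> //; first by rewrite SG Fd dE.
  by rewrite (subsetP sA).
apply: conclusion_le c3ge Cc3 K1 nm _ _ _ => //.
have k40 : 0 < 2 * k4 by rewrite mulr_gt0 // (lt_le_trans _ k41).
apply: le_trans mbig _; rewrite -k4E ler_pM2l // ler_nat.
rewrite -(card_sumset1 _ (- b)).
apply/subset_leq_card/subsetP=> x /imset2P[a c + /set1P-> ->].
rewrite inE => /andP[aA abV]; rewrite inE; apply/andP; split.
  by apply/imsetP; exists a; rewrite // (subsetP sA).
by rewrite (subsetP sV) // SG.
Qed.

End Main.

(* Real powers, logarithms and the final statement *)
From mathcomp Require Import all_classical all_reals all_analysis.

Lemma ln_nat_ge_half (R : realType) (q : nat) : (1 < q)%N -> 1 / 2 <= ln (q%:R : R).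
Proof.
move=> q1; apply: le_trans (_ : ln 2 <= _); last first.
  by rewrite ler_ln ?posrE ?ltr0n ?ler_nat // ltnW.
have h : ln (1 + (- 2^-1 : R)) <= - 2^-1 by apply: le_ln1Dx; lra.
move: h; have -> : 1 + (- 2^-1 : R) = 2^-1 by lra.
by rewrite lnV ?posrE //; lra.
Qed.

Theorem corollary1 (R : realType) :
  exists C k : R, [/\ 0 < C, 0 < k &
    forall (F : finFieldType) (p : nat) (charFp : p \in [pchar F])
           (A X : {set F}) (K : R),
    let q : R := #|F|%:R in
    A \subset [set~ 0] -> X \subset [set~ 0] -> 0 < K ->
    C * ln q `^ k * K ^+ 1504 <= #|X|%:R ->
    C * ln q `^ k * q `^ (1 / 4) * K ^+ 4 <= #|X|%:R ->
    #|X|%:R < q `^ (1 / 2) ->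
    C * ln q `^ k * q `^ (1 / 2) * K ^+ 85 <= #|A|%:R ->
    #|A|%:R <= q `^ (2 / 3) ->
    (forall xi : F, xi \in X ->
       #|A|%:R ^+ 3 / K <= (energy_dilate A xi)%:R) ->
    exists (S : {subfield fieldExt_of charFp}) (abar : F)
           (V : {vspace fieldOver S}),
      [/\ #|subfield_set S|%:R = q `^ (1 / 3), abar \in A, \dim V = 2%N &
          C^-1 * ln q `^ (- k) * K ^- 85 * #|A|%:R
            <= #|translate A abar :&: subspace_set V|%:R]].
Proof.
pose c0 : R := 2 ^+ 54; pose c1 := (24 * c0 ^+ 2) ^+ 24; pose c3 := (4 * c0) ^+ 4.
pose c2 := (3 * (64 * c3 ^+ 3)) ^+ 3.
pose C := 2 ^+ 14 + ((2 * c1) ^+ 3 + (c2 ^+ 3 + 48 * c3)).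
have c0E : c0 = 2 ^+ 54 by [].
have c00 : 0 <= c0 by rewrite c0E exprn_ge0.
have c10 : 0 <= c1 by rewrite exprn_ge0 // mulr_ge0 // exprn_ge0.
have c30 : 0 <= c3 by rewrite exprn_ge0 // mulr_ge0.
have c20 : 0 <= c2 by rewrite exprn_ge0 // mulr_ge0 // mulr_ge0 // exprn_ge0.
have t1 : 0 <= (2 * c1) ^+ 3 by rewrite exprn_ge0 // mulr_ge0.
have t2 : 0 <= c2 ^+ 3 by rewrite exprn_ge0.
have t3 : 0 <= 48 * c3 by rewrite mulr_ge0.
have t4 : 0 < 2 ^+ 14 :> R by rewrite exprn_gt0.
clearbody c0.
have [Cc1 Cc2 Cc3 C14] : [/\ (2 * c1) ^+ 3 <= C, c2 ^+ 3 <= C, 48 * c3 <= C & 2 ^+ 14 <= C].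
  rewrite /C; move: t1 t2 t3 t4; move: ((2 * c1) ^+ 3) (c2 ^+ 3) (48 * c3) (2 ^+ 14).
  by move=> a b c d ? ? ? ?; split; lra.
have Cpos : 0 < C by apply: lt_le_trans C14.
(* As [ln q >= 1 / 2], the factor 2 and [k = 1] make [2 * C * ln q] dominate the constant [C]. *)
exists (2 * C), 1; split; [by rewrite mulr_gt0|by []|].
move=> F p charFp A X K q _ sX K0 XK Xq Xlt Aq Alt energyX.
have q1 : (1 < #|F|)%N by rewrite finNzRing_gt1.
have q0 : 0 < q by rewrite ltr0n ltnW.
have lnq : 1 / 2 <= ln q by apply: ln_nat_ge_half.
have ln0 : 0 < ln q by apply: lt_le_trans lnq; rewrite divr_gt0.
rewrite powRr1 ?(ltW ln0) // in XK Xq Aq.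
have Cln : C <= 2 * C * ln q.
  have : C * (1 / 2) <= C * ln q by rewrite ler_pM2l.
  by rewrite -[2 * C * _]mulrA; move: (C * ln q) => t; lra.
pose s := q `^ (6^-1).
have s0 : 0 < s by rewrite powR_gt0.
have sX_ (r : R) (e : nat) : r = 6^-1 * e%:R -> q `^ r = s ^+ e.
  by move=> ->; rewrite powRrM powR_mulrn // ltW.
have e12 : q `^ (1 / 2) = s ^+ 3 by apply: sX_; field.
have e13 : q `^ (1 / 3) = s ^+ 2 by apply: sX_; field.
have e23 : q `^ (2 / 3) = s ^+ 4 by apply: sX_; field.
have sF : s ^+ 6 = q by rewrite -(sX_ 1) ?powRr1 ?(ltW q0) //; field.
have X0 : 0 \notin X.
  by apply/negP=> /(fintype.subsetP sX); rewrite !inE eqxx.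
have KX e : 0 < K ^+ e by rewrite exprn_gt0.
have h1 : C * K ^+ 1504 <= #|X|%:R by apply: le_trans XK; rewrite ler_pM2r.
(* [q^(1/4)] is not an integer power of [s], but its square is [s^3]; hence the squared form. *)
have h2 : C ^+ 2 * s ^+ 3 * K ^+ 8 <= #|X|%:R ^+ 2.
  have u0 : 0 < q `^ (1 / 4) by rewrite powR_gt0.
  have uE : q `^ (1 / 4) ^+ 2 = s ^+ 3.
    by rewrite -powR_mulrn ?(ltW u0) // -powRrM; apply: sX_; field.
  rewrite -uE [leLHS](_ : _ = (C * q `^ (1 / 4) * K ^+ 4) ^+ 2).
    apply: lerXn2r; rewrite ?nnegrE //; first by rewrite ltW // !mulr_gt0.
    by apply: le_trans Xq; rewrite ler_pM2r // ler_pM2r.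
  by move: (q `^ (1 / 4)) => u; ring.
have h3 : #|X|%:R < s ^+ 3 by rewrite -e12.
have h4 : C * s ^+ 3 * K ^+ 85 <= #|A|%:R.
  by apply: le_trans Aq; rewrite e12 ler_pM2r // ler_pM2r // exprn_gt0.
have h5 : #|A|%:R <= s ^+ 4 by rewrite -e23.
have [S [b [V [SF bA dimV ASV]]]] := plane_concentration charFp c0E Cc1 Cc2 Cc3 C14
  X0 K0 s0 sF h1 h2 h3 h4 h5 energyX.
exists S, b, V; split=> //.
  rewrite e13; apply: (@pexpIrn _ 3); rewrite ?nnegrE ?exprn_ge0 ?(ltW s0) //.
  by rewrite -natrX SF -exprM.
rewrite powR_inv1 ?(ltW ln0) // -!invfM mulrC ler_pdivrMr; last first.
  by rewrite !mulr_gt0.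
apply: le_trans ASV _; rewrite mulrC ler_wpM2l // ler_pM2r //.
Qed.
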